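(* Let $(\Omega_{\mathbb{D}},\Sigma_{\mathbb{D}},\mu_{\mathbb{D}})$ be a $\mathbb{D}$-finite measure space and $\varphi_{\mathbb{D}}:\mathbb{D}^+\to\mathbb{D}^+$ a $\mathbb{D}$-valued Young function. The $\mathbb{BC}$-module $\mathcal{L}_{\mathbb{D}}^{\varphi_{\mathbb{D}}}(\Omega_{\mathbb{D}},\Sigma_{\mathbb{D}},\mu_{\mathbb{D}})$ with the $\mathbb{D}$-Luxemburg norm $\|\cdot\|_{\mathbb{D}}^{\varphi_{\mathbb{D}}}$ is a complete $\mathbb{D}$-normed module.
   Context: $\mathbb{BC}=\{z_1+jz_2:z_1,z_2\in\mathbb{C}(i)\}$ with $i^2=j^2=-1$, $ij=ji$, is the ring of bicomplex numbers; $k=ij$, $k^2=1$, $e_1=\frac12(1+k)$, $e_2=\frac12(1-k)$; every $Z\in\mathbb{BC}$ is uniquely $Z=w_1e_1+w_2e_2$ with $w_1,w_2\in\mathbb{C}(i)$ and $|Z|_k:=|w_1|e_1+|w_2|e_2$. The hyperbolic numbers are $\mathbb{D}=\{\alpha e_1+\beta e_2:\alpha,\beta\in\mathbb{R}\}\subset\mathbb{BC}$; $\mathbb{D}^+$ are those with $\alpha,\beta\ge0$; $\le'$ is the componentwise order, $\alpha>'0$ means both components positive, and $x<'\infty$ means both components finite. Infima and suprema in $\mathbb{D}$ are componentwise. A $\mathbb{D}$-finite measure is a countably additive set function $\mu_{\mathbb{D}}=\mu_{\mathbb{D}}^1e_1+\mu_{\mathbb{D}}^2e_2:\Sigma_{\mathbb{D}}\to\mathbb{D}^+$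 on a $\sigma$-algebra, i.e. $\mu_{\mathbb{D}}^1,\mu_{\mathbb{D}}^2$ are finite positive measures. A function $f=f_1e_1+f_2e_2:\Omega_{\mathbb{D}}\to\mathbb{BC}$ is $\Sigma_{\mathbb{D}}$-measurable when its complex components $f_1,f_2$ are. For measurable $F=F_1e_1+F_2e_2\ge'0$, $\int F\,d\mu_{\mathbb{D}}=\left(\int F_1d\mu_{\mathbb{D}}^1\right)e_1+\left(\int F_2d\mu_{\mathbb{D}}^2\right)e_2$. Functions are identified when $f_1=g_1$ $\mu_{\mathbb{D}}^1$-a.e. and $f_2=g_2$ $\mu_{\mathbb{D}}^2$-a.e. A Young function $\varphi_{\mathbb{D}}$ is $\mathbb{D}$-convex ($\varphi_{\mathbb{D}}(\alpha x+(1-\alpha)y)\le'\alpha\varphi_{\mathbb{D}}(x)+(1-\alpha)\varphi_{\mathbb{D}}(y)$ for $0\le'\alpha\le'1$, $\alpha\in\mathbb{D}$), $\varphi_{\mathbb{D}}(0)=0$, and $\varphi_{\mathbb{D}}(x)\to+\infty$ as $x\to\infty$ along every line (ray) in $\mathbb{D}^+$, where ''$+\infty$'' means that at least one idempotent component is infinite. It decomposes as $\varphi_{\mathbb{D}}(x)=\varphi_{\mathbb{D}_1}(e_1x)e_1+\varphi_{\mathbb{D}_2}(e_2x)e_2$. $\mathcal{L}_{\mathbb{D}}^{\varphi_{\mathbb{D}}}$ is the set of (classes of) measurable $f:\Omega_{\mathbb{D}}\to\mathbb{BC}$ with $\int\varphi_{\mathbb{D}}(|\alpha f|_k)\,d\mu_{\mathbb{D}}<'\infty$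 for some $\alpha\in\mathbb{D}$, $\alpha>'0$. The modular is $I_{\varphi_{\mathbb{D}}}^{\mathbb{D}}(f)=\int_{\Omega_{\mathbb{D}}}\varphi_{\mathbb{D}}(|f|_k)\,d\mu_{\mathbb{D}}$, and the $\mathbb{D}$-Luxemburg norm is $\|f\|_{\mathbb{D}}^{\varphi_{\mathbb{D}}}=\inf\{\alpha>'0:I_{\varphi_{\mathbb{D}}}^{\mathbb{D}}(|f|_k/\alpha)\le'1\}$ (here $1=e_1+e_2$). A $\mathbb{D}$-norm on a $\mathbb{BC}$-module $X$ is a map $\|\cdot\|_{\mathbb{D}}:X\to\mathbb{D}^+$ with $\|x\|_{\mathbb{D}}=0$ iff $x=0$, $\|\alpha x\|_{\mathbb{D}}=|\alpha|_k\|x\|_{\mathbb{D}}$ for $\alpha\in\mathbb{BC}$, and $\|x+y\|_{\mathbb{D}}\le'\|x\|_{\mathbb{D}}+\|y\|_{\mathbb{D}}$. Completeness means that every sequence Cauchy for $\|x-y\|_{\mathbb{D}}$ (for every $\epsilon>'0$, eventually $\|x_n-x_m\|_{\mathbb{D}}<'\epsilon$, i.e. strict inequality in both components) converges. *)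

(* Defs.v *)
From HB Require Import structures.
From mathcomp Require Import all_boot all_order all_algebra.
From mathcomp Require Import complex ring.
From mathcomp Require Import all_classical all_reals all_analysis measurable_realfun.
From mathcomp Require Import ring_quotient.

Set Implicit Arguments.
Unset Strict Implicit.
Unset Printing Implicit Defensive.

Import Order.TTheory GRing.Theory Num.Theory.
Import numFieldNormedType.Exports.

Local Open Scope classical_set_scope.
Local Open Scope ring_scope.
Local Open Scope complex_scope.
Local Open Scope quotient_scope.

(* [Bicomplex z1 z2] is z1 + j z2, with z1 z2 in C(i) and j^2 = -1. *)
Record bicomplex (R : Type) := Bicomplex { bc_z1 : R[i]; bc_z2 : R[i] }.

Section bicomplex_ring.
Variable R : realType.
Local Notation BC := (bicomplex R).
Implicit Types x y z : BC.

Definition bc_pair x : R[i] * R[i] := (bc_z1 x, bc_z2 x).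
Definition pair_bc (p : R[i] * R[i]) : BC := Bicomplex p.1 p.2.
Lemma bc_pairK : cancel bc_pair pair_bc. Proof. by case. Qed.
HB.instance Definition _ := Choice.copy BC (can_type bc_pairK).

Definition bc_add x y := Bicomplex (bc_z1 x + bc_z1 y) (bc_z2 x + bc_z2 y).
Definition bc_opp x := Bicomplex (- bc_z1 x) (- bc_z2 x).
Definition bc_mul x y :=
  Bicomplex (bc_z1 x * bc_z1 y - bc_z2 x * bc_z2 y)
            (bc_z1 x * bc_z2 y + bc_z2 x * bc_z1 y).

Lemma bc_eqP x y : bc_z1 x = bc_z1 y -> bc_z2 x = bc_z2 y -> x = y.
Proof. by case: x y => [? ?] [? ?] /= -> ->. Qed.

Fact bc_addA : associative bc_add.
Proof. by move=> x y z; apply: bc_eqP; rewrite /= addrA. Qed.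
Fact bc_addC : commutative bc_add.
Proof. by move=> x y; apply: bc_eqP; rewrite /= addrC. Qed.
Fact bc_add0 : left_id (Bicomplex 0 0) bc_add.
Proof. by move=> x; apply: bc_eqP; rewrite /= add0r. Qed.
Fact bc_addN : left_inverse (Bicomplex 0 0) bc_opp bc_add.
Proof. by move=> x; apply: bc_eqP; rewrite /= addNr. Qed.
HB.instance Definition _ :=
  GRing.isZmodule.Build BC bc_addA bc_addC bc_add0 bc_addN.

Fact bc_mulA : associative bc_mul.
Proof. by move=> x y z; apply: bc_eqP => /=; ring. Qed.
Fact bc_mulC : commutative bc_mul.
Proof. by move=> x y; apply: bc_eqP => /=; ring. Qed.
Fact bc_mul1 : left_id (Bicomplex 1 0) bc_mul.
Proof. by move=> x; apply: bc_eqP => /=; ring. Qed.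
Fact bc_mulDl : left_distributive bc_mul +%R.
Proof. by move=> x y z; apply: bc_eqP => /=; ring. Qed.
Fact bc_oner_neq0 : Bicomplex 1 0 != 0 :> BC.
Proof. by apply/eqP => -[/eqP]; rewrite oner_eq0. Qed.
HB.instance Definition _ := GRing.Zmodule_isComNzRing.Build BC
  bc_mulA bc_mulC bc_mul1 bc_mulDl bc_oner_neq0.

Definition bcC (w : R[i]) : BC := Bicomplex w 0.
Definition bcj : BC := Bicomplex 0 1.
Definition bck : BC := bcC 'i * bcj.
Definition bce1 : BC := bcC 2^-1 * (1 + bck).
Definition bce2 : BC := bcC 2^-1 * (1 - bck).

(* idempotent components: x = w1 e1 + w2 e2 with these w1, w2, see
   [bc_idempotentE] and [bcwE] *)
Definition bcw1 x : R[i] := bc_z1 x - 'i * bc_z2 x.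
Definition bcw2 x : R[i] := bc_z1 x + 'i * bc_z2 x.

Lemma bcw1D x y : bcw1 (x + y) = bcw1 x + bcw1 y.
Proof. by rewrite /bcw1 /=; ring. Qed.
Lemma bcw2D x y : bcw2 (x + y) = bcw2 x + bcw2 y.
Proof. by rewrite /bcw2 /=; ring. Qed.
Lemma mulii : 'i * 'i = -1 :> R[i].
Proof. by rewrite -expr2 sqr_i. Qed.
Lemma bcw1M x y : bcw1 (x * y) = bcw1 x * bcw1 y.
Proof.
rewrite /bcw1 /=; have h := mulii.
transitivity (bc_z1 x * bc_z1 y + (-1) * (bc_z2 x * bc_z2 y)
  - 'i * (bc_z1 x * bc_z2 y + bc_z2 x * bc_z1 y)); first by ring.
by rewrite -h; ring.
Qed.
Lemma bcw2M x y : bcw2 (x * y) = bcw2 x * bcw2 y.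
Proof.
rewrite /bcw2 /=; have h := mulii.
transitivity (bc_z1 x * bc_z1 y + (-1) * (bc_z2 x * bc_z2 y)
  + 'i * (bc_z1 x * bc_z2 y + bc_z2 x * bc_z1 y)); first by ring.
by rewrite -h; ring.
Qed.

Lemma bcwE (w1 w2 : R[i]) :
  (bcw1 (bcC w1 * bce1 + bcC w2 * bce2) = w1) *
  (bcw2 (bcC w1 * bce1 + bcC w2 * bce2) = w2).
Proof.
have c1 w : bcw1 (bcC w) = w by rewrite /bcw1 /= mulr0 subr0.
have c2 w : bcw2 (bcC w) = w by rewrite /bcw2 /= mulr0 addr0.
have k1 : bcw1 bck = 1 by rewrite bcw1M c1 /bcw1 /= mulr1 sub0r mulrN mulii opprK.
have k2 : bcw2 bck = -1 by rewrite bcw2M c2 /bcw2 /= mulr1 add0r mulii.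
have o1 : bcw1 1 = 1 := c1 1.
have o2 : bcw2 1 = 1 := c2 1.
have n1 x : bcw1 (- x) = - bcw1 x by rewrite /bcw1 /=; ring.
have n2 x : bcw2 (- x) = - bcw2 x by rewrite /bcw2 /=; ring.
rewrite !(bcw1D, bcw2D, bcw1M, bcw2M, c1, c2, k1, k2, o1, o2, n1, n2).
by split; field.
Qed.

Lemma bc_idempotentE x : x = bcC (bcw1 x) * bce1 + bcC (bcw2 x) * bce2.
Proof.
have inj u v : bcw1 u = bcw1 v -> bcw2 u = bcw2 v -> u = v.
  move=> h1 h2; have hs : bcw1 u + bcw2 u = bcw1 v + bcw2 v by rewrite h1 h2.
  have hd : 'i * (bcw1 u - bcw2 u) = 'i * (bcw1 v - bcw2 v) by rewrite h1 h2.
  have n2 : (2 : R[i]) != 0 by rewrite pnatr_eq0.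
  apply: bc_eqP; apply: (mulfI n2).
    have e z : bcw1 z + bcw2 z = 2 * bc_z1 z by rewrite /bcw1 /bcw2; ring.
    by rewrite -!e.
  have e z : 'i * (bcw1 z - bcw2 z) = 2 * bc_z2 z.
    transitivity (- ('i * 'i) * (2 * bc_z2 z)); first by rewrite /bcw1 /bcw2; ring.
    by rewrite mulii opprK mul1r.
  by rewrite -!e.
by apply: inj; rewrite bcwE.
Qed.

End bicomplex_ring.

(* The hyperbolic number alpha e1 + beta e2 is the pair (alpha, beta), with
   the componentwise ring structure of pairs; [D_bc] realises it in BC. *)
Notation hyperbolic R := (R * R)%type (only parsing).

Section hyperbolic.
Variable R : realType.
Local Notation BC := (bicomplex R).
Local Notation D := (hyperbolic R).

Definition D_bc (a : D) : BC := bcC a.1%:C * bce1 R + bcC a.2%:C * bce2 R.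

Definition D_le (a b : D) : Prop := a.1 <= b.1 /\ a.2 <= b.2.
Definition D_lt (a b : D) : Prop := a.1 < b.1 /\ a.2 < b.2.

Definition D_inf (A : set D) : D := (inf (fst @` A), inf (snd @` A)).

(* For w : R[i], `|w| is an element of R[i] whose imaginary part is zero. *)
Definition bc_abs (Z : BC) : D :=
  (complex.Re `|bcw1 Z|, complex.Re `|bcw2 Z|).

End hyperbolic.

Notation "a <=' b" := (D_le a b) (at level 70) : ring_scope.
Notation "a <' b" := (D_lt a b) (at level 70) : ring_scope.

Section hyperbolic_lemmas.
Variable R : realType.
Implicit Types a b : hyperbolic R.

Lemma D_bc_inj : injective (@D_bc R).
Proof.
move=> [a1 a2] [b1 b2] /= h.
have /= := congr1 (@bcw1 R) h; have /= := congr1 (@bcw2 R) h.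
by rewrite /D_bc !bcwE => -[->] [->].
Qed.

Lemma bcw1_D a : bcw1 (D_bc a) = a.1%:C. Proof. by rewrite /D_bc bcwE. Qed.
Lemma bcw2_D a : bcw2 (D_bc a) = a.2%:C. Proof. by rewrite /D_bc bcwE. Qed.

Lemma D_bcD a b : D_bc (a + b) = D_bc a + D_bc b.
Proof.
rewrite (bc_idempotentE (_ + _)) bcw1D bcw2D !bcw1_D !bcw2_D.
by rewrite -!rmorphD.
Qed.

Lemma D_bcM a b : D_bc (a * b) = D_bc a * D_bc b.
Proof.
rewrite [RHS]bc_idempotentE bcw1M bcw2M !bcw1_D !bcw2_D.
by rewrite -!rmorphM.
Qed.

Lemma D_bc1 : D_bc (1 : hyperbolic R) = 1.
Proof.
rewrite [RHS]bc_idempotentE.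
by rewrite /bcw1 /bcw2 /= mulr0 subr0 addr0.
Qed.

Lemma bc_abs_D a : bc_abs (D_bc a) = (`|a.1|, `|a.2|).
Proof. by rewrite /bc_abs bcw1_D bcw2_D !normc_def /= !expr0n !addr0 !sqrtr_sqr. Qed.

Lemma D_divE a b : 0 <' b -> a / b = (a.1 / b.1, a.2 / b.2).
Proof.
case: a b => [a1 a2] [b1 b2] [/= b10 b20].
have bU : ((b1, b2) : hyperbolic R) \is a GRing.unit.
  by apply/unitrP; exists (b1^-1, b2^-1); split; congr pair;
    rewrite /= ?mulVf ?mulfV ?gt_eqF.
apply: (mulIr bU); rewrite divrK//; congr pair => /=;
  by rewrite divfK ?gt_eqF.
Qed.

End hyperbolic_lemmas.

(* [L] is a subset of the ambient BC-module [V]; that it is a BC-module for the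
   induced operations is part of [complete_D_normed_module]. *)
Section D_normed_module.
Variables (R : realType) (V : lmodType (bicomplex R)).
Variables (L : set V) (N : V -> hyperbolic R).

Definition bc_submodule :=
  [/\ L 0, forall x y, L x -> L y -> L (x + y)
    & forall (a : bicomplex R) x, L x -> L (a *: x)].

Definition D_norm :=
  [/\ forall x, L x -> 0 <=' N x,
      forall x, L x -> (N x = 0 <-> x = 0),
      forall (a : bicomplex R) x, L x -> N (a *: x) = bc_abs a * N x
    & forall x y, L x -> L y -> N (x + y) <=' N x + N y].

Definition D_cauchy (u : nat -> V) :=
  forall e : hyperbolic R, 0 <' e -> exists n0 : nat,
    forall n m, (n0 <= n)%N -> (n0 <= m)%N -> N (u n - u m) <' e.

Definition D_converges (u : nat -> V) (l : V) :=
  forall e : hyperbolic R, 0 <' e -> exists n0 : nat,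
    forall n, (n0 <= n)%N -> N (u n - l) <' e.

Definition D_complete :=
  forall u : nat -> V, (forall n, L (u n)) -> D_cauchy u ->
    exists2 l, L l & D_converges u l.

Definition complete_D_normed_module := [/\ bc_submodule, D_norm & D_complete].

End D_normed_module.

(* The D-finite measure mu = mu1 e1 + mu2 e2, given by its components. *)
Record D_finite_measure (d : measure_display) (T : measurableType d)
    (R : realType) := DFiniteMeasure {
  Dmu1 : {finite_measure set T -> \bar R} ;
  Dmu2 : {finite_measure set T -> \bar R} }.

(* [bicomplex R]^o is BC seen as a module over itself, so that functions with
   values in it form a BC-module. *)
Section measurable_classes.
Variables (d : measure_display) (T : measurableType d) (R : realType).
Local Notation BC := (bicomplex R).
Local Notation fBC := (T -> BC^o).

Definition C_measurable (g : T -> R[i]) :=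
  measurable_fun setT (fun x => complex.Re (g x)) /\
  measurable_fun setT (fun x => complex.Im (g x)).

Definition BC_measurable (f : fBC) :=
  C_measurable (fun x => bcw1 (f x)) /\ C_measurable (fun x => bcw2 (f x)).

Definition BC_mfun_pred : {pred fBC} := fun f => `[< BC_measurable f >].

Fact C_measurable_cst (c : R[i]) : C_measurable (fun=> c).
Proof. by split; exact: measurable_cst. Qed.

Fact C_measurableD g h : C_measurable g -> C_measurable h ->
  C_measurable (fun x => g x + h x).
Proof.
move=> [g1 g2] [h1 h2]; split.
  have -> : (fun x => complex.Re (g x + h x)) =
    (fun x => complex.Re (g x)) \+ (fun x => complex.Re (h x)).
    by apply/funext => x /=; case: (g x) (h x) => [? ?] [? ?].
  exact: measurable_funD.
have -> : (fun x => complex.Im (g x + h x)) =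
  (fun x => complex.Im (g x)) \+ (fun x => complex.Im (h x)).
  by apply/funext => x /=; case: (g x) (h x) => [? ?] [? ?].
exact: measurable_funD.
Qed.

Fact C_measurableZ (c : R[i]) g : C_measurable g ->
  C_measurable (fun x => c * g x).
Proof.
move=> [g1 g2]; case: c => a b; split.
  have -> : (fun x => complex.Re ((a +i* b) * g x)) =
    (fun x => a * complex.Re (g x)) \- (fun x => b * complex.Im (g x)).
    by apply/funext => x /=; case: (g x).
  by apply: measurable_funB; apply: measurable_funM.
have -> : (fun x => complex.Im ((a +i* b) * g x)) =
  (fun x => a * complex.Im (g x)) \+ (fun x => b * complex.Re (g x)).
  by apply/funext => x /=; case: (g x).
by apply: measurable_funD; apply: measurable_funM.
Qed.

Fact BC_mfun_submod_closed : submod_closed BC_mfun_pred.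
Proof.
split.
  apply/asboolP; split.
    exact: (C_measurable_cst (bcw1 (0 : BC))).
  exact: (C_measurable_cst (bcw2 (0 : BC))).
move=> a f g /asboolP[f1 f2] /asboolP[g1 g2]; apply/asboolP; split.
  rewrite (_ : (fun x => _) = fun x => bcw1 a * bcw1 (f x) + bcw1 (g x)).
    by apply: C_measurableD => //; apply: C_measurableZ.
  by apply/funext => x; rewrite -bcw1M -bcw1D.
rewrite (_ : (fun x => _) = fun x => bcw2 a * bcw2 (f x) + bcw2 (g x)).
  by apply: C_measurableD => //; apply: C_measurableZ.
by apply/funext => x; rewrite -bcw2M -bcw2D.
Qed.

HB.instance Definition _ :=
  GRing.isSubmodClosed.Build BC fBC BC_mfun_pred BC_mfun_submod_closed.

Record BC_mfun := BCMfun { BC_fun :> fBC ; _ : BC_fun \in BC_mfun_pred }.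

HB.instance Definition _ := [isSub for BC_fun].
HB.instance Definition _ := [Choice of BC_mfun by <:].
HB.instance Definition _ := [SubChoice_isSubLmodule of BC_mfun by <:].

Lemma BC_mfun_measurable (f : BC_mfun) : BC_measurable f.
Proof. by case: f => f /= /asboolP. Qed.

Variable mu : D_finite_measure T R.

Definition BC_ae_eq (f g : fBC) :=
  {ae Dmu1 mu, forall x, bcw1 (f x) = bcw1 (g x)} /\
  {ae Dmu2 mu, forall x, bcw2 (f x) = bcw2 (g x)}.

Definition BC_null : {pred BC_mfun} := fun f => `[< BC_ae_eq f 0 >].

Fact BC_null_submod_closed : submod_closed BC_null.
Proof.
split; first by apply/asboolP; split; apply: filterE.
move=> a f g /asboolP[f1 f2] /asboolP[g1 g2]; apply/asboolP; split.
  apply: (filterS2 _ _ f1 g1) => x fx gx.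
  rewrite bcw1D bcw1M fx gx.
  by rewrite /bcw1 /= !(mulr0, subr0, addr0).
apply: (filterS2 _ _ f2 g2) => x fx gx.
rewrite bcw2D bcw2M fx gx.
by rewrite /bcw2 /= !(mulr0, addr0).
Qed.

HB.instance Definition _ :=
  GRing.isSubmodClosed.Build BC BC_mfun BC_null BC_null_submod_closed.

(* The BC-module of measurable functions modulo [BC_ae_eq], see [BC_L0P]. *)
Definition BC_L0 : Type := Quotient.quot BC_null.
HB.instance Definition _ := GRing.Zmodule.on BC_L0.
HB.instance Definition _ := EqQuotient.on BC_L0.

Lemma BC_L0P (f g : BC_mfun) : \pi_BC_L0 f = \pi_BC_L0 g <-> BC_ae_eq f g.
Proof.
have -> : (\pi_BC_L0 f = \pi_BC_L0 g) <-> BC_ae_eq (f - g) 0.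
  split=> [/eqP|h]; first by rewrite -Quotient.idealrBE => /asboolP.
  by apply/eqP; rewrite -Quotient.idealrBE; apply/asboolP.
have p1 x y : bcw1 (x - y) = bcw1 (0 : BC) <-> bcw1 x = bcw1 y.
  rewrite bcw1D; split=> [|->]; last first.
    by rewrite -bcw1D subrr.
  move=> h; have := congr1 (+%R^~ (bcw1 y)) h.
  by rewrite /= -addrA -!bcw1D addNr add0r addr0.
have p2 x y : bcw2 (x - y) = bcw2 (0 : BC) <-> bcw2 x = bcw2 y.
  rewrite bcw2D; split=> [|->]; last first.
    by rewrite -bcw2D subrr.
  move=> h; have := congr1 (+%R^~ (bcw2 y)) h.
  by rewrite /= -addrA -!bcw2D addNr add0r addr0.
split=> -[h1 h2]; split.
- by apply: (filterS _ h1) => x /p1.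
- by apply: (filterS _ h2) => x /p2.
- by apply: (filterS _ h1) => x /p1.
- by apply: (filterS _ h2) => x /p2.
Qed.

Definition BC_L0_scale (a : BC) (c : BC_L0) : BC_L0 := \pi_BC_L0 (a *: (repr c : BC_mfun)).

Lemma BC_L0_pi_scale a (f : BC_mfun) :
  \pi_BC_L0 (a *: f) = BC_L0_scale a (\pi_BC_L0 f).
Proof.
apply/eqP; rewrite -Quotient.idealrBE -scalerBr rpredZ//.
by rewrite Quotient.idealrBE reprK.
Qed.

Lemma BC_L0_piD (f g : BC_mfun) : \pi_BC_L0 (f + g) = \pi_BC_L0 f + \pi_BC_L0 g.
Proof. by rewrite (Quotient.pi_add BC_null). Qed.

Fact BC_L0_scaleA a b c :
  BC_L0_scale a (BC_L0_scale b c) = BC_L0_scale (a * b) c.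
Proof.
elim/quotW: c => f.
rewrite -(BC_L0_pi_scale b f) -(BC_L0_pi_scale a (b *: f)).
by rewrite -(BC_L0_pi_scale (a * b) f) scalerA.
Qed.
Fact BC_L0_scale1 : left_id 1 BC_L0_scale.
Proof. by elim/quotW => f; rewrite -BC_L0_pi_scale scale1r. Qed.
Fact BC_L0_scaleDr : right_distributive BC_L0_scale +%R.
Proof.
move=> a; elim/quotW => f; elim/quotW => g.
rewrite -BC_L0_piD -(BC_L0_pi_scale a (f + g)).
by rewrite -(BC_L0_pi_scale a f) -(BC_L0_pi_scale a g) scalerDr BC_L0_piD.
Qed.
Fact BC_L0_scaleDl c : {morph BC_L0_scale^~ c : a b / a + b}.
Proof.
elim/quotW: c => f a b.
rewrite -(BC_L0_pi_scale (a + b) f) -(BC_L0_pi_scale a f).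
by rewrite -(BC_L0_pi_scale b f) scalerDl BC_L0_piD.
Qed.
HB.instance Definition _ := GRing.Zmodule_isLmodule.Build BC BC_L0
  BC_L0_scaleA BC_L0_scale1 BC_L0_scaleDr BC_L0_scaleDl.

End measurable_classes.

Section orlicz.
Variables (d : measure_display) (T : measurableType d) (R : realType).
Local Notation D := (hyperbolic R).
Local Notation fBC := (T -> (bicomplex R)^o).
Variables (mu : D_finite_measure T R) (phi : D -> D).

(* Only the values of [phi] on D^+ are constrained, or ever used below. In the
   last clause the ray {a + t v : t >= 0} lies in D^+ iff 0 <=' a and 0 <=' v. *)
Definition D_young :=
  [/\ forall x : D, 0 <=' x -> 0 <=' phi x,
      forall a x y : D, 0 <=' a -> a <=' 1 -> 0 <=' x -> 0 <=' y ->
        phi (a * x + (1 - a) * y) <=' a * phi x + (1 - a) * phi y,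
      phi 0 = 0
    & forall a v : D, 0 <=' a -> 0 <=' v -> v <> 0 ->
        ((phi (a + (t, t) * v)).1 @[t --> +oo] --> +oo) \/
        ((phi (a + (t, t) * v)).2 @[t --> +oo] --> +oo)].

Definition D_integral (F : T -> D) : \bar R * \bar R :=
  (\int[Dmu1 mu]_x ((F x).1)%:E, \int[Dmu2 mu]_x ((F x).2)%:E)%E.

Definition D_modular (f : fBC) : \bar R * \bar R :=
  D_integral (fun x => phi (bc_abs (f x))).

Definition D_orlicz_fun (f : fBC) : Prop :=
  exists2 a : D, 0 <' a &
    let I := D_modular (fun x => D_bc a * f x) in (I.1 < +oo /\ I.2 < +oo)%E.

Definition D_luxemburg_fun (f : fBC) : D :=
  D_inf [set a : D | 0 <' a /\
    let I := D_modular (fun x => D_bc (bc_abs (f x) / a)) in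
    (I.1 <= 1 /\ I.2 <= 1)%E].

Definition D_orlicz : set (BC_L0 mu) := [set c | D_orlicz_fun (repr c : BC_mfun T R)].

Definition D_luxemburg (c : BC_L0 mu) : D := D_luxemburg_fun (repr c : BC_mfun T R).

Lemma D_young_split (x y : D) : D_young -> 0 <=' x -> 0 <=' y ->
  (x.1 = y.1 -> (phi x).1 = (phi y).1) /\ (x.2 = y.2 -> (phi x).2 = (phi y).2).
Proof.
case=> _ cvx _ _.
have h1 (u v : D) : 0 <=' u -> 0 <=' v -> u.1 = v.1 -> (phi v).1 <= (phi u).1.
  move=> u0 v0 uv.
  have [] := cvx (1, 0) u v (conj ler01 (lexx _)) (conj (lexx _) ler01) u0 v0.
  rewrite /= !mul1r subrr !mul0r addr0 => + _.
  rewrite (_ : _ + _ = v)//; case: v uv {v0} => v1 v2 /= uv.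
  by apply/pair_equal_spec; rewrite /= !mul1r !mul0r subrr mul0r subr0 mul1r addr0 add0r.
have h2 (u v : D) : 0 <=' u -> 0 <=' v -> u.2 = v.2 -> (phi v).2 <= (phi u).2.
  move=> u0 v0 uv.
  have [] := cvx (0, 1) u v (conj (lexx _) ler01) (conj ler01 (lexx _)) u0 v0.
  rewrite /= !mul1r subrr !mul0r addr0 => _.
  rewrite (_ : _ + _ = v)//; case: v uv {v0} => v1 v2 /= uv.
  by apply/pair_equal_spec; rewrite /= !mul1r !mul0r subrr mul0r subr0 mul1r addr0 add0r.
by move=> x0 y0; split=> e; apply/eqP; rewrite eq_le ?h1 ?h2.
Qed.

Lemma D_young_mono (x y : D) : D_young -> 0 <=' x -> 0 <=' y ->
  (x.1 <= y.1 -> (phi x).1 <= (phi y).1) /\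
  (x.2 <= y.2 -> (phi x).2 <= (phi y).2).
Proof.
move=> phiY x0 y0; have [pos cvx phi0 _] := phiY.
have [py1 py2] := pos _ y0; have [x01 x02] := x0; have [y01 y02] := y0.
have key (s t : R) : 0 <= s -> s <= t -> exists2 c, 0 <= c <= 1 & s = c * t.
  move=> s0 st; have [t0|t0] := eqVneq t 0.
    by exists 0; rewrite ?lexx ?ler01// mul0r; apply/le_anti; rewrite s0 -t0 st.
  have tp : 0 < t by rewrite lt_neqAle eq_sym t0 (le_trans s0 st).
  exists (s / t); last by rewrite divfK.
  by rewrite divr_ge0 ?(ltW tp)//= ler_pdivrMr// mul1r.
have le00 : (0 : D) <=' 0 by split; exact: lexx.
split=> xy.
  have [c /andP[c0 c1] xE] := key _ _ x01 xy.
  have [+ _] := cvx (c, 0) y 0 (conj c0 (lexx _)) (conj c1 ler01) y0 le00.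
  have -> : ((c, 0) : D) * y + (1 - (c, 0)) * 0 = (x.1, 0).
    by rewrite mulr0 addr0 xE; congr pair; rewrite /= mul0r.
  rewrite phi0 mulr0 addr0 /= => h.
  have [-> // _] := @D_young_split x (x.1, 0) phiY x0 (conj x01 (lexx _)).
  by apply: (le_trans h); rewrite ler_piMl.
have [c /andP[c0 c1] xE] := key _ _ x02 xy.
have [_ +] := cvx (0, c) y 0 (conj (lexx _) c0) (conj ler01 c1) y0 le00.
have -> : ((0, c) : D) * y + (1 - (0, c)) * 0 = (0, x.2).
  by rewrite mulr0 addr0 xE; congr pair; rewrite /= mul0r.
rewrite phi0 mulr0 addr0 /= => h.
have [_ -> //] := @D_young_split x (0, x.2) phiY x0 (conj (lexx _) x02).
by apply: (le_trans h); rewrite ler_piMl.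
Qed.

Lemma C_measurable_abs (g : T -> R[i]) : C_measurable g ->
  measurable_fun setT (fun x => complex.Re `|g x|).
Proof.
move=> [g1 g2]; under eq_fun do rewrite normc_def /=.
apply: (measurableT_comp (f := @Num.sqrt R)).
  by apply: continuous_measurable_fun; exact: sqrt_continuous.
by apply: measurable_funD; apply: measurable_funX.
Qed.

Lemma bc_abs_ge0 (Z : bicomplex R) : 0 <=' bc_abs Z.
Proof. by rewrite /bc_abs !normc_def; split; exact: sqrtr_ge0. Qed.

Lemma D_modular_measurable (f : fBC) : D_young -> BC_measurable f ->
  measurable_fun setT (fun x => (phi (bc_abs (f x))).1) /\
  measurable_fun setT (fun x => (phi (bc_abs (f x))).2).
Proof.
move=> phiY [mf1 mf2].
have pm (t : R) : 0 <= Num.max t 0 by rewrite le_max lexx orbT.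
have pm1 t : 0 <=' ((Num.max t 0, 0) : D) by split => /=.
have pm2 t : 0 <=' ((0, Num.max t 0) : D) by split => /=.
split.
  have -> : (fun x => (phi (bc_abs (f x))).1) =
      (fun t => (phi (Num.max t 0, 0)).1) \o (fun x => (bc_abs (f x)).1).
    apply/funext => x /=; have a0 := bc_abs_ge0 (f x).
    have [h _] := D_young_split phiY a0 (pm1 (bc_abs (f x)).1); apply: h.
    by rewrite /= max_l//; case: a0.
  apply: measurableT_comp; last exact: C_measurable_abs.
  apply: nondecreasing_measurable => // s t st.
  have [h _] := D_young_mono phiY (pm1 s) (pm1 t); apply: h => /=.
  by rewrite ge_max !le_max st lexx !orbT.
have -> : (fun x => (phi (bc_abs (f x))).2) =
    (fun t => (phi (0, Num.max t 0)).2) \o (fun x => (bc_abs (f x)).2).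
  apply/funext => x /=; have a0 := bc_abs_ge0 (f x).
  have [_ h] := D_young_split phiY a0 (pm2 (bc_abs (f x)).2); apply: h.
  by rewrite /= max_l//; case: a0.
apply: measurableT_comp; last exact: C_measurable_abs.
apply: nondecreasing_measurable => // s t st.
have [_ h] := D_young_mono phiY (pm2 s) (pm2 t); apply: h => /=.
by rewrite ge_max !le_max st lexx !orbT.
Qed.

Lemma D_modular_ae (f g : fBC) : D_young ->
  BC_measurable f -> BC_measurable g -> BC_ae_eq mu f g ->
  D_modular f = D_modular g.
Proof.
move=> phiY mf mg [fg1 fg2]; have [pos _ _ _] := phiY.
have [mf1 mf2] := D_modular_measurable phiY mf.
have [mg1 mg2] := D_modular_measurable phiY mg.
congr pair.
  apply: ge0_ae_eq_integral => //; try exact/measurable_EFinP.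
  - by move=> x _; rewrite lee_fin; case: (pos _ (bc_abs_ge0 (f x))).
  - by move=> x _; rewrite lee_fin; case: (pos _ (bc_abs_ge0 (g x))).
  apply: (filterS _ fg1) => x e _; congr EFin.
  have [h _] := D_young_split phiY (bc_abs_ge0 (f x)) (bc_abs_ge0 (g x)).
  apply: h.
  by rewrite /bc_abs /= e.
apply: ge0_ae_eq_integral => //; try exact/measurable_EFinP.
- by move=> x _; rewrite lee_fin; case: (pos _ (bc_abs_ge0 (f x))).
- by move=> x _; rewrite lee_fin; case: (pos _ (bc_abs_ge0 (g x))).
apply: (filterS _ fg2) => x e _; congr EFin.
have [_ h] := D_young_split phiY (bc_abs_ge0 (f x)) (bc_abs_ge0 (g x)).
apply: h.
by rewrite /bc_abs /= e.
Qed.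

Lemma D_orlicz_ae (f g : BC_mfun T R) : D_young -> BC_ae_eq mu f g ->
  D_orlicz_fun f -> D_orlicz_fun g.
Proof.
move=> phiY fg.
have E (a : D) : D_modular (fun x => D_bc a * f x) =
    D_modular (fun x => D_bc a * g x).
  apply: (D_modular_ae phiY).
  - exact: (BC_mfun_measurable (D_bc a *: f)).
  - exact: (BC_mfun_measurable (D_bc a *: g)).
  case: fg => fg1 fg2; split.
    by apply: (filterS _ fg1) => x e; rewrite !bcw1M e.
  by apply: (filterS _ fg2) => x e; rewrite !bcw2M e.
pose P (M : D -> \bar R * \bar R) : Prop :=
  exists2 a : D, 0 <' a & ((M a).1 < +oo /\ (M a).2 < +oo)%E.
have PE := congr1 P (funext E); move=> h.
by change (P (fun a => D_modular (fun x => D_bc a * g x))); rewrite -PE.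
Qed.

Lemma D_luxemburg_ae (f g : BC_mfun T R) : D_young -> BC_ae_eq mu f g ->
  D_luxemburg_fun f = D_luxemburg_fun g.
Proof.
move=> phiY fg.
have mD (a : D) (h : BC_mfun T R) :
    BC_measurable (fun x => D_bc (bc_abs (h x) / a)).
  have [m1 m2] := BC_mfun_measurable h.
  split; split; under eq_fun do rewrite (bcw1_D, bcw2_D) /=;
    try exact: measurable_cst;
    apply: measurable_funM; (try exact: measurable_cst);
    exact: C_measurable_abs.
have E (a : D) : D_modular (fun x => D_bc (bc_abs (f x) / a)) =
    D_modular (fun x => D_bc (bc_abs (g x) / a)).
  apply: (D_modular_ae phiY (mD a f) (mD a g)).
  case: fg => fg1 fg2; split.
    by apply: (filterS _ fg1) => x e; rewrite !bcw1_D /= e.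
  by apply: (filterS _ fg2) => x e; rewrite !bcw2_D /= e.
exact: (congr1 (fun M : D -> \bar R * \bar R =>
  D_inf [set a : D | 0 <' a /\ ((M a).1 <= 1 /\ (M a).2 <= 1)%E]) (funext E)).
Qed.

Lemma BC_ae_eq_repr (f : BC_mfun T R) :
  BC_ae_eq mu (repr (\pi_(BC_L0 mu) f) : BC_mfun T R) f /\
  BC_ae_eq mu f (repr (\pi_(BC_L0 mu) f) : BC_mfun T R).
Proof. by split; apply/BC_L0P; rewrite reprK. Qed.

(* The definitions on classes do not depend on the representative. *)
Lemma D_orlicz_pi (f : BC_mfun T R) : D_young ->
  D_orlicz (\pi_(BC_L0 mu) f) <-> D_orlicz_fun f.
Proof.
by move=> phiY; have [h1 h2] := BC_ae_eq_repr f; split; apply: D_orlicz_ae.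
Qed.

Lemma D_luxemburg_pi (f : BC_mfun T R) : D_young ->
  D_luxemburg (\pi_(BC_L0 mu) f) = D_luxemburg_fun f.
Proof.
by move=> phiY; have [h1 h2] := BC_ae_eq_repr f; apply: D_luxemburg_ae.
Qed.

End orlicz.

Arguments D_orlicz {d T R} mu phi.
Arguments D_luxemburg {d T R} mu phi c.

(* Main.v *)
(* Everything splits along the idempotents: D_young decouples phi into two real
   Young functions, and module, norm and completeness are those of two complex
   Orlicz spaces.  For a real Young function p, convexity yields the triangle
   inequality.  For completeness, pass to a subsequence whose increments have
   norms below 2^-(k+1): the partial sums of the absolute increments have norm
   below 1, hence modular at most 1, and monotone convergence with p --> +oo
   bounds them almost everywhere.  The subsequence converges almost everywhere,
   and Fatou's lemma turns this into convergence in norm.  The same boundedness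
   argument, applied to the multiples n |h|, shows that lux h = 0 forces h = 0
   almost everywhere. *)
Require Import Defs.
From mathcomp Require Import all_boot all_order all_algebra.
From mathcomp Require Import complex ring lra.
From mathcomp Require Import all_classical all_reals all_analysis.
From mathcomp Require Import measurable_realfun.

Set Implicit Arguments.
Unset Strict Implicit.
Unset Printing Implicit Defensive.

Import Order.TTheory GRing.Theory Num.Theory.
Import numFieldNormedType.Exports.

Local Open Scope classical_set_scope.
Local Open Scope ring_scope.

(** * Complex moduli, rapid subsequences, lower limits *)

Section preliminaries.
Variable R : realType.
Implicit Types z : R[i].

(** The norm of [R[i]] is valued in [R[i]], while the scalar theory below needs a real number. The
    two components of [bc_abs] are of this form. *)
Definition cmod (z : R[i]) : R := complex.Re `|z|.

Lemma cmodE (z : R[i]) : cmod z = Num.sqrt (complex.Re z ^+ 2 + complex.Im z ^+ 2).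
Proof. by rewrite /cmod normc_def. Qed.

Lemma normcE (z : R[i]) : `|z| = (cmod z)%:C%C.
Proof. by rewrite cmodE normc_def. Qed.

Lemma cmod_ge0 z : 0 <= cmod z.
Proof. by rewrite cmodE sqrtr_ge0. Qed.

Lemma cmod0_eq0 z : cmod z = 0 <-> z = 0.
Proof.
split=> [z0|->]; last by rewrite /cmod normr0.
by apply/normr0_eq0; rewrite normcE z0.
Qed.

Lemma cmodM z1 z2 : cmod (z1 * z2) = cmod z1 * cmod z2.
Proof. by rewrite /cmod normrM !normcE -rmorphM. Qed.

Lemma cmodN z : cmod (- z) = cmod z.
Proof. by rewrite /cmod normrN. Qed.

Lemma cmodD z1 z2 : cmod (z1 + z2) <= cmod z1 + cmod z2.
Proof. by have := ler_normD z1 z2; rewrite !normcE -rmorphD lecR. Qed.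

Lemma ReB (z1 z2 : R[i]) : complex.Re (z1 - z2) = complex.Re z1 - complex.Re z2.
Proof. by case: z1 z2 => [? ?] [? ?]. Qed.

Lemma ImB (z1 z2 : R[i]) : complex.Im (z1 - z2) = complex.Im z1 - complex.Im z2.
Proof. by case: z1 z2 => [? ?] [? ?]. Qed.

Lemma Re_le_cmod z : `|complex.Re z| <= cmod z.
Proof. by rewrite cmodE -sqrtr_sqr ler_wsqrtr// lerDl sqr_ge0. Qed.

Lemma Im_le_cmod z : `|complex.Im z| <= cmod z.
Proof. by rewrite cmodE -sqrtr_sqr ler_wsqrtr// lerDr sqr_ge0. Qed.

Lemma cvg_cmod (z : nat -> R[i]) (l : R[i]) :
  complex.Re (z n) @[n --> \oo] --> complex.Re l ->
  complex.Im (z n) @[n --> \oo] --> complex.Im l ->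
  cmod (z n) @[n --> \oo] --> cmod l.
Proof.
move=> zr zi; under eq_fun do rewrite cmodE; rewrite cmodE.
apply: continuous_cvg; first exact: sqrt_continuous.
by apply: cvgD; apply: cvgM.
Qed.

Lemma cmodR (a : R) : cmod a%:C%C = `|a|.
Proof. by rewrite cmodE /= expr0n addr0 sqrtr_sqr. Qed.

Lemma bcw1_0 : bcw1 (0 : bicomplex R) = 0.
Proof. by rewrite /bcw1 /= mulr0 subr0. Qed.

Lemma bcw2_0 : bcw2 (0 : bicomplex R) = 0.
Proof. by rewrite /bcw2 /= mulr0 addr0. Qed.

(** If [N k] is a Cauchy threshold for 2^-(k+1), the index k + N 0 + ... + N k and its successor in
    the sequence both exceed [N k]. The bound [k <= phi k] later sends tails of the subsequence into
    tails of the full sequence. *)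
Lemma rapid_subsequence (D : nat -> nat -> R) :
  (forall e, 0 < e -> exists n0, forall n k, (n0 <= n)%N -> (n0 <= k)%N -> D n k < e) ->
  exists phi : nat -> nat, (forall k, (k <= phi k)%N) /\
    forall k, D (phi k.+1) (phi k) < 2^-1 ^+ k.+1.
Proof.
move=> DC.
have /choice[N NP] k : exists n0, forall n k', (n0 <= n)%N -> (n0 <= k')%N ->
    D n k' < 2^-1 ^+ k.+1 by apply: DC; rewrite exprn_gt0.
exists (fun k => (k + \sum_(i < k.+1) N i)%N); split=> k; first exact: leq_addr.
apply: NP; last by rewrite big_ord_recr/= addnA leq_addl.
by rewrite 2!big_ord_recr/= addnAC addnA leq_addl.
Qed.

(** The lower limit is a supremum of infima over the sets of the filter, and the set where the bound
    holds is one of them. *)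
Lemma limn_einf_ge (c : \bar R) (u : nat -> \bar R) :
  (\forall n \near \oo, c <= u n)%E -> (c <= limn_einf u)%E.
Proof.
move=> cu; rewrite [limn_einf _]limf_einfE; apply: le_ereal_sup_tmp.
exists (ereal_inf (u @` [set n | (c <= u n)%E])); first by exists [set n | (c <= u n)%E].
by apply: le_ereal_inf_tmp => _ [n /= cn <-].
Qed.

Variables (d : measure_display) (T : measurableType d).
Implicit Types u v : T -> R[i].

Lemma measurable_cmod u : C_measurable u -> measurable_fun setT (fun x => cmod (u x)).
Proof. exact: C_measurable_abs. Qed.

Lemma C_measurableB u v : C_measurable u -> C_measurable v ->
  C_measurable (fun x => u x - v x).
Proof.
move=> mu mv; under eq_fun do rewrite -[X in _ + X]mulN1r.
by apply: C_measurableD => //; exact: C_measurableZ.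
Qed.

End preliminaries.

(* Young functions on [0, +oo[, extended evenly to R: [young_le] with equal
   absolute values gives p (- s) = p s. *)
Record young_fun (R : realType) (p : R -> R) : Prop := YoungFun {
  young_ge0 : forall s, 0 <= p s ;
  young_at0 : p 0 = 0 ;
  young_le : forall s t, `|s| <= `|t| -> p s <= p t ;
  young_cvx : forall c s t, 0 <= c <= 1 ->
    p (c * s + (1 - c) * t) <= c * p s + (1 - c) * p t ;
  young_unbounded : forall M, exists t, M < p t }.

(** * The Luxemburg norm of a real Young function *)

Section scalar_orlicz.
Variables (d : measure_display) (T : measurableType d) (R : realType).
Variables (m : {measure set T -> \bar R}) (p : R -> R).
Hypothesis pY : young_fun p.
Implicit Types (f g h : T -> R) (a b c : R).

(** By evenness [p] factors through the absolute value; truncating at 0 makes the outer factor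
    nondecreasing on the whole line, hence Borel. *)
Lemma young_measurable : measurable_fun setT p.
Proof.
have -> : p = (fun t => p (Num.max t 0)) \o (fun t => `|t|).
  apply/funext => t /=; rewrite max_l//.
  by apply/eqP; rewrite eq_le; apply/andP; split; apply: (young_le pY); rewrite normr_id.
apply: measurableT_comp; last exact: normr_measurable.
apply: nondecreasing_measurable => // s t st.
have st' : Num.max s 0 <= Num.max t 0 by rewrite ge_max !le_max st lexx !orbT.
by apply: (young_le pY); rewrite !ger0_norm// le_max lexx orbT.
Qed.

(** Dividing by the scale serves both membership and norm: a multiplier alpha in [D_orlicz_fun]
    becomes the scale alpha^-1. *)
Definition modular h a := (\int[m]_x (p (h x / a))%:E)%E.
Definition orlicz h := exists2 a, 0 < a & (modular h a < +oo)%E.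
Definition luxset h := [set a : R | 0 < a /\ (modular h a <= 1)%E].
Definition lux h := inf (luxset h).

Lemma modular_fun_measurable h a : measurable_fun setT h ->
  measurable_fun setT (fun x => (p (h x / a))%:E).
Proof.
move=> mh; apply/measurable_EFinP.
by apply: (measurableT_comp young_measurable); apply: measurable_funM.
Qed.

Lemma modular_ge0 h a : (0 <= modular h a)%E.
Proof. by apply: integral_ge0 => x _; rewrite lee_fin young_ge0. Qed.

Lemma le_modular g h a b : measurable_fun setT g -> measurable_fun setT h ->
  {ae m, forall x, `|g x / a| <= `|h x / b|} -> (modular g a <= modular h b)%E.
Proof.
move=> mg mh gh; apply: ae_ge0_le_integral => //.
- by move=> x _; rewrite lee_fin young_ge0.
- exact: modular_fun_measurable.
- by move=> x _; rewrite lee_fin young_ge0.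
- exact: modular_fun_measurable.
by apply: filterS gh => x gh _; rewrite lee_fin; apply: young_le pY _ _ _.
Qed.

(** (g + h) / (a + b) is the convex combination of g / a and h / b with weights a / (a + b) and b /
    (a + b). This one estimate yields both stability under sums and the triangle inequality. *)
Lemma modularD g h a b : measurable_fun setT g -> measurable_fun setT h ->
  0 < a -> 0 < b ->
  (modular (fun x => g x + h x)%R (a + b) <=
   (a / (a + b))%:E * modular g a + (b / (a + b))%:E * modular h b)%E.
Proof.
move=> mg mh a0 b0; have ab0 : 0 < a + b by exact: addr_gt0.
have ga : 0 <= a / (a + b) by rewrite divr_ge0 ?ltW.
have gb : 0 <= b / (a + b) by rewrite divr_ge0 ?ltW.
have pp h' c x : (0 <= (p (h' x / c))%:E)%E by rewrite lee_fin young_ge0.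
have mm h' c := @modular_fun_measurable h' c.
rewrite -!ge0_integralZl_EFin//; try by [exact: mm | move=> x _; exact: pp].
rewrite -ge0_integralD//=; last 4 first.
- by move=> x _; rewrite mule_ge0// lee_fin.
- by apply: measurable_funeM; exact: mm.
- by move=> x _; rewrite mule_ge0// lee_fin.
- by apply: measurable_funeM; exact: mm.
apply: ge0_le_integral => //=.
- by move=> x _; exact: (pp (fun x => g x + h x)).
- by apply: (mm (fun x => g x + h x)); exact: measurable_funD.
- by apply: emeasurable_funD; apply: measurable_funeM; exact: mm.
move=> x _; rewrite -!EFinM -EFinD lee_fin.
have -> : b / (a + b) = 1 - a / (a + b) by field; rewrite gt_eqF.
have -> : (g x + h x) / (a + b) =
    a / (a + b) * (g x / a) + (1 - a / (a + b)) * (h x / b).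
  by field; rewrite !gt_eqF.
by apply: (young_cvx pY); rewrite ga/= ler_pdivrMr// mul1r lerDl ltW.
Qed.

(** Convexity against [p 0 = 0] gives p (c s) <= c p s for c in [0, 1]. If the modular at scale a is
    r, then at scale a (1 + r) it is at most r / (1 + r) <= 1. *)
Lemma luxset_has_inf h : measurable_fun setT h -> orlicz h ->
  has_inf (luxset h).
Proof.
move=> mh [a a0 Ifin]; split; last by exists 0 => b [/ltW].
have [r rE] : exists r, modular h a = r%:E.
  by exists (fine (modular h a)); rewrite fineK// ge0_fin_numE// modular_ge0.
have r0 : 0 <= r by have := modular_ge0 h a; rewrite rE lee_fin.
have r1 : 0 < 1 + r by lra.
exists (a * (1 + r)); split; first exact: mulr_gt0.
have rp : 0 <= (1 + r)^-1 by rewrite invr_ge0 ltW.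
apply: (@le_trans _ _ (((1 + r)^-1)%:E * modular h a)%E); last first.
  by rewrite rE -EFinM lee_fin mulrC ler_pdivrMr// mul1r lerDr.
rewrite -ge0_integralZl_EFin//; last 2 first.
- by move=> x _; rewrite lee_fin young_ge0.
- exact: modular_fun_measurable.
apply: ge0_le_integral => //=.
- by move=> x _; rewrite lee_fin young_ge0.
- exact: modular_fun_measurable.
- by apply: measurable_funeM; exact: modular_fun_measurable.
move=> x _; rewrite -EFinM lee_fin.
have := young_cvx pY (c := (1 + r)^-1) (h x / a) 0.
rewrite (young_at0 pY) !mulr0 !addr0 rp/= invf_le1// lerDl => /(_ r0).
by have -> : h x / (a * (1 + r)) = (1 + r)^-1 * (h x / a) by rewrite invfM; ring.
Qed.

Lemma lux_le h a : luxset h a -> lux h <= a.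
Proof. by move=> ha; apply: ge_inf => //; exists 0 => b [/ltW]. Qed.

Lemma luxset_up h a b : measurable_fun setT h -> luxset h a -> a <= b ->
  luxset h b.
Proof.
move=> mh [a0 ha] ab; have b0 := lt_le_trans a0 ab; split => //.
apply: le_trans ha; apply: le_modular => //; apply: filterE => x.
rewrite !normrM ler_wpM2l// !gtr0_norm ?invr_gt0//.
by rewrite lef_pV2.
Qed.

(** Scales strictly above the infimum are admissible because [luxset] is upward closed. Estimates at
    the infimum itself are therefore made up to an epsilon. *)
Lemma lux_lt h a : measurable_fun setT h -> orlicz h -> lux h < a ->
  luxset h a.
Proof.
move=> mh oh ha; have e0 : 0 < a - lux h by rewrite subr_gt0.
have [b hb] := inf_adherent e0 (luxset_has_inf mh oh).
by rewrite addrC subrK => /ltW; exact: luxset_up hb.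
Qed.

Lemma lux_ge0 h : 0 <= lux h.
Proof.
(* The infimum of the empty set is 0 by default. *)
have [E|/eqP/set0P h0] := pselect (luxset h = set0); first by rewrite /lux E inf0.
by apply: lb_le_inf => // b [/ltW].
Qed.

Lemma le_orlicz g h : measurable_fun setT g -> measurable_fun setT h ->
  {ae m, forall x, `|g x| <= `|h x|} -> orlicz h -> orlicz g.
Proof.
move=> mg mh gh [a a0 ha]; exists a => //.
apply: le_lt_trans ha; apply: le_modular => //.
by apply: filterS gh => x gh; rewrite !normrM ler_wpM2r.
Qed.

Lemma le_lux g h : measurable_fun setT g -> measurable_fun setT h ->
  {ae m, forall x, `|g x| <= `|h x|} -> orlicz h -> lux g <= lux h.
Proof.
move=> mg mh gh oh; apply: lb_le_inf; first by case: (luxset_has_inf mh oh).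
move=> a [a0 ha]; apply: lux_le; split => //.
apply: le_trans ha; apply: le_modular => //.
by apply: filterS gh => x gh; rewrite !normrM ler_wpM2r.
Qed.

Lemma orliczD g h : measurable_fun setT g -> measurable_fun setT h ->
  orlicz g -> orlicz h -> orlicz (fun x => g x + h x).
Proof.
move=> mg mh [a a0 ga] [b b0 hb]; exists (a + b); first exact: addr_gt0.
apply: (le_lt_trans (modularD mg mh a0 b0)).
by rewrite lte_add_pinfty// lte_mul_pinfty ?lee_fin ?divr_ge0 ?addr_ge0 ?(ltW a0) ?(ltW b0).
Qed.

Lemma luxsetD g h a b : measurable_fun setT g -> measurable_fun setT h ->
  luxset g a -> luxset h b -> luxset (fun x => g x + h x) (a + b).
Proof.
move=> mg mh [a0 ga] [b0 hb]; have ab0 : 0 < a + b by exact: addr_gt0.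
split=> //; apply: (le_trans (modularD mg mh a0 b0)).
have ra : 0 <= a / (a + b) by rewrite divr_ge0// ltW.
have rb : 0 <= b / (a + b) by rewrite divr_ge0// ltW.
have ab1 : (1 : R) = a / (a + b) * 1 + b / (a + b) * 1.
  by rewrite !mulr1 -mulrDl divff// gt_eqF.
rewrite [leRHS](congr1 EFin ab1) EFinD !EFinM.
by apply: leeD; apply: lee_wpmul2l; rewrite ?lee_fin.
Qed.

Lemma luxD g h : measurable_fun setT g -> measurable_fun setT h ->
  orlicz g -> orlicz h -> lux (fun x => g x + h x) <= lux g + lux h.
Proof.
move=> mg mh og oh; apply/ler_addgt0Pr => e e0.
have ga : luxset g (lux g + e / 2) by apply: lux_lt; rewrite // ltrDl divr_gt0.
have hb : luxset h (lux h + e / 2) by apply: lux_lt; rewrite // ltrDl divr_gt0.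
have := lux_le (luxsetD mg mh ga hb).
have -> // : lux g + e / 2 + (lux h + e / 2) = lux g + lux h + e.
by rewrite addrACA -splitr.
Qed.

Lemma modularZ c h a : c != 0 -> modular (fun x => c * h x) (c * a) = modular h a.
Proof.
move=> c0; apply: eq_integral => x _; congr (p _)%:E.
by rewrite invfM mulrACA divff// mul1r.
Qed.

Lemma lux_eq0W h : measurable_fun setT h -> {ae m, forall x, h x = 0} ->
  lux h = 0.
Proof.
move=> mh h0; apply/le_anti; rewrite lux_ge0 andbT.
apply/ler_addgt0Pr => e e0; rewrite add0r; apply: lux_le; split => //.
apply: (@le_trans _ _ (modular (fun=> 0) 1)); last first.
  rewrite /modular; under eq_integral do rewrite mul0r (young_at0 pY).
  by rewrite integral0.
by apply: le_modular => //; apply: filterS h0 => x ->; rewrite !mul0r.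
Qed.

Lemma orlicz0 : orlicz (fun=> 0).
Proof.
exists 1 => //; rewrite /modular.
under eq_integral do rewrite mul0r (young_at0 pY).
by rewrite integral0.
Qed.

Lemma orliczZ c h : 0 <= c -> measurable_fun setT h -> orlicz h -> orlicz (fun x => c * h x).
Proof.
rewrite le_eqVlt => /predU1P[<- _ _|c0 mh [a a0 ha]].
  by rewrite (_ : (fun _ => _) = fun=> 0)//; [exact: orlicz0|apply/funext => x; rewrite mul0r].
by exists (c * a); [exact: mulr_gt0|rewrite modularZ// gt_eqF].
Qed.

Lemma luxZ_le c h : 0 < c -> measurable_fun setT h -> orlicz h ->
  lux (fun x => c * h x) <= c * lux h.
Proof.
move=> c0 mh oh; rewrite mulrC -ler_pdivrMr//.
apply/ler_addgt0Pr => e e0; rewrite ler_pdivrMr// mulrC.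
have [a0 ha] : luxset h (lux h + e) by apply: lux_lt; rewrite // ltrDl.
by apply: lux_le; split; [exact: mulr_gt0|rewrite modularZ// gt_eqF].
Qed.

Lemma luxZ c h : 0 <= c -> measurable_fun setT h -> orlicz h ->
  lux (fun x => c * h x) = c * lux h.
Proof.
rewrite le_eqVlt => /predU1P[<- mh oh|c0 mh oh].
  rewrite mul0r lux_eq0W//; first exact: measurable_funM.
  by apply: filterE => x; rewrite mul0r.
apply/le_anti; rewrite luxZ_le//= mulrC -ler_pdivlMr// mulrC.
have mch : measurable_fun setT (fun x => c * h x) by exact: measurable_funM.
(* The reverse inequality is the direct one applied to the scalar c^-1 and the function c h. *)
have := luxZ_le (c := c^-1) _ mch (orliczZ (ltW c0) mh oh).
rewrite invr_gt0 => /(_ c0); congr (lux _ <= _).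
by apply/funext => x; rewrite mulKf// gt_eqF.
Qed.

(** By monotone convergence the pointwise limit of p (S n x) has integral at most 1, so it is finite
    almost everywhere; unboundedness of [p] turns a finite limit into a bound on S n x. *)
Lemma ae_bounded (S : nat -> T -> R) :
  (forall n, measurable_fun setT (S n)) -> (forall n x, 0 <= S n x) ->
  (forall x n k, (n <= k)%N -> S n x <= S k x) ->
  (forall n, (modular (S n) 1 <= 1)%E) ->
  {ae m, forall x, exists B, forall n, S n x <= B}.
Proof.
move=> mS S0 Sinc S1; pose G n x := (p (S n x / 1))%:E.
have mG n : measurable_fun setT (G n) by exact: modular_fun_measurable.
have G0 n x : (0 <= G n x)%E by rewrite lee_fin young_ge0.
have Ginc x : {homo G^~ x : n k / (n <= k)%N >-> (n <= k)%E}.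
  move=> n k nk; rewrite lee_fin !divr1; apply: (young_le pY).
  by rewrite !ger0_norm// Sinc.
have mlim : measurable_fun setT (fun x => limn (G^~ x)).
  by apply: emeasurable_fun_cvg (mG) _ => x _; exact: ereal_nondecreasing_is_cvgn.
have lim_ge n x : (G n x <= limn (G^~ x))%E.
  rewrite (cvg_lim _ (ereal_nondecreasing_cvgn (Ginc x)))//.
  by apply: ereal_sup_ubound; exists n.
have lim_ge0 x : (0 <= limn (G^~ x))%E by exact: le_trans (G0 0%N x) (lim_ge 0%N x).
have Ilim : (\int[m]_x limn (G^~ x) <= 1)%E.
  have cv := cvg_monotone_convergence (mu := m) measurableT mG
    (fun n x _ => G0 n x) (fun x _ => Ginc x).
  rewrite -(cvg_lim _ cv)//; apply: lime_le; first by apply/cvg_ex; eexists; exact: cv.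
  by apply: nearW => n; exact: S1.
have integ : m.-integrable setT (fun x => limn (G^~ x)).
  apply/integrableP; split => //.
  under eq_integral do rewrite gee0_abs//.
  exact: le_lt_trans Ilim (ltry _).
apply: filterS (integrable_ae measurableT integ) => x /(_ I) fin.
(* Take t with p t beyond the limit: a value S n x > |t| would force p (S n x) >= p t by
   monotonicity. *)
have [t pt] := young_unbounded pY (fine (limn (G^~ x))).
exists `|t| => n; rewrite leNgt; apply/negP => tS.
have := lim_ge n x; rewrite -(fineK fin) lee_fin divr1 leNgt => /negP; apply.
by apply: (lt_le_trans pt); apply: (young_le pY); rewrite (ger0_norm (S0 n x)) ltW.
Qed.

Lemma lux_eq0 h : measurable_fun setT h -> orlicz h -> lux h = 0 ->
  {ae m, forall x, h x = 0}.
Proof.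
move=> mh oh h0; pose S n x := n%:R * `|h x|.
have mS n : measurable_fun setT (S n).
  by apply: measurable_funM => //; exact: measurableT_comp mh.
have := ae_bounded mS; case.
- by move=> n x; rewrite mulr_ge0.
- by move=> x n k nk; rewrite ler_wpM2r// ler_nat.
- move=> n.
  (* The scale 1 / (n + 1), unlike 1 / n, is positive at n = 0 too; n |h| is dominated by (n + 1)
     |h|. *)
  have [] : luxset h (n.+1%:R^-1) by apply: lux_lt; rewrite // h0 invr_gt0.
  move=> _; apply: le_trans; apply: le_modular => //; apply: filterE => x.
  rewrite divr1 invrK !normrM normr_id mulrC ler_wpM2l// !ger0_norm//.
  by rewrite ler_nat.
move=> A [mA A0 hA]; exists A; split => // x /= hx; apply: hA => /= -[B hB].
apply: hx; apply/eqP; apply/negP => /negP hx0.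
have hx1 : 0 < `|h x| by rewrite normr_gt0.
(* This index exceeds |B| / |h x|, so the corresponding multiple of |h x| exceeds B. *)
have := hB (Num.truncn (`|B| / `|h x|)).+1; rewrite /S -ler_pdivlMr// leNgt => /negP; apply.
apply: (@le_lt_trans _ _ (`|B| / `|h x|)); first by rewrite ler_pM2r ?invr_gt0// ler_norm.
by rewrite truncnS_gt.
Qed.

(** The partial sums S n of the absolute increments fall under [ae_bounded], so the telescoping
    series converges absolutely at almost every point. *)
Lemma ae_is_cvgn (w : nat -> T -> R) :
  (forall n, measurable_fun setT (w n)) ->
  (forall n, orlicz (fun x => w n.+1 x - w n x)) ->
  (forall n, lux (fun x => w n.+1 x - w n x) < 2^-1 ^+ n.+1) ->
  {ae m, forall x, cvgn (fun n => w n x)}.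
Proof.
move=> mw ow lw; pose S n x := \sum_(0 <= k < n) `|w k.+1 x - w k x|.
have mD k : measurable_fun setT (fun x => w k.+1 x - w k x) by exact: measurable_funB.
have mN k : measurable_fun setT (fun x => `|w k.+1 x - w k x|) by exact: measurableT_comp.
have oN k : orlicz (fun x => `|w k.+1 x - w k x|).
  by apply: le_orlicz (mN k) (mD k) _ (ow k); apply: filterE => x; rewrite normr_id.
have lN k : lux (fun x => `|w k.+1 x - w k x|) <= 2^-1 ^+ k.+1.
  apply: le_trans (ltW (lw k)); apply: le_lux (mN k) (mD k) _ (ow k).
  by apply: filterE => x; rewrite normr_id.
have SS n : S n.+1 = fun x => S n x + `|w n.+1 x - w n x|.
  by apply/funext => x; rewrite /S big_nat_recr.
have mS n : measurable_fun setT (S n).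
  by rewrite /S; apply: measurable_sum.
have S0E : S 0%N = fun=> 0 by apply/funext => x; rewrite /S big_geq.
have oS n : orlicz (S n).
  elim: n => [|n IH]; first by rewrite S0E; exact: orlicz0.
  by rewrite SS; exact: orliczD.
(* The right-hand side is the sum of 2^-(k+1) for k < n. It is strictly below 1, which is what
   [lux_lt] needs to make the scale 1 admissible. *)
have lS n : lux (S n) <= 1 - 2^-1 ^+ n.
  elim: n => [|n IH].
    by rewrite S0E expr0 subrr lux_eq0W//; exact: filterE.
  rewrite SS; apply: le_trans (luxD (mS n) (mN n) (oS n) (oN n)) _.
  have := lerD IH (lN n); congr (_ <= _).
  by rewrite exprS; field.
have S1 n : (modular (S n) 1 <= 1)%E.
  have [] // : luxset (S n) 1.
  apply: lux_lt (mS n) (oS n) _; apply: le_lt_trans (lS n) _.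
  by rewrite ltrBlDr ltrDl exprn_gt0.
have Sinc x n k : (n <= k)%N -> S n x <= S k x.
  by move=> nk; rewrite /S (@big_cat_nat _ _ _ n 0%N k)//= lerDl sumr_ge0.
apply: filterS (ae_bounded mS (fun n x => sumr_ge0 _ (fun k _ => normr_ge0 _)) Sinc S1).
move=> x [B SB].
have cS : cvgn (series (telescope (fun n => w n x))).
  apply: normed_cvg; apply: nondecreasing_is_cvgn; first by move=> n k; exact: Sinc.
  by exists B => _ [n _ <-]; exact: SB.
rewrite (_ : (fun n => w n x) = fun n => series (telescope (fun n => w n x)) n + w 0%N x).
  by apply: is_cvgD => //; exact: is_cvg_cst.
by apply/funext => n; rewrite telescopeK subrK.
Qed.

(* Fatou's lemma, at the price of a factor 2 that spares the continuity of [p]. *)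
Lemma luxset_fatou (H : nat -> T -> R) h a : 0 < a ->
  (forall n, measurable_fun setT (H n)) -> measurable_fun setT h ->
  {ae m, forall x, H n x @[n --> \oo] --> h x} ->
  (\forall n \near \oo, luxset (H n) a) -> luxset h (2 * a).
Proof.
move=> a0 mH mh Hh Ha; split; first exact: mulr_gt0.
pose G n x := (p (H n x / a))%:E.
have mG n : measurable_fun setT (G n) by exact: modular_fun_measurable.
apply: (@le_trans _ _ (\int[m]_x limn_einf (G^~ x))%E).
  apply: ae_ge0_le_integral => //.
  - by move=> x _; rewrite lee_fin young_ge0.
  - exact: modular_fun_measurable.
  - move=> x _; apply: (limn_einf_ge (c := 0%E)); apply: nearW => n.
    by rewrite lee_fin young_ge0.
  - by apply: measurableT_comp => //; apply: measurable_fun_limn_esup => n;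
    exact: measurableT_comp.
  apply: filterS Hh => x Hx _; apply: limn_einf_ge.
  have [h0|h0] := eqVneq (h x) 0.
    by apply: nearW => n; rewrite h0 mul0r (young_at0 pY) lee_fin young_ge0.
  (* Here the factor 2 is spent: eventually |H n x| >= |h x| / 2, so h x / (2 a) is dominated by H n
     x / a and monotonicity of [p] concludes. *)
  have h2 : 0 < `|h x| / 2 by rewrite divr_gt0// normr_gt0.
  move/cvgr_dist_le: Hx => /(_ _ h2); apply: filterS => n hn.
  rewrite lee_fin; apply: (young_le pY); rewrite invfM mulrA !normrM ler_wpM2r//.
  rewrite (ger0_norm (x := 2^-1))//.
  have := ler_normD (h x - H n x) (H n x); rewrite subrK; lra.
apply: (le_trans (fatou m measurableT mG _)).
  by move=> n x _; rewrite lee_fin young_ge0.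
(* Every set V of the filter contains an index where the modular is at most 1, which bounds the
   infimum over V. *)
rewrite [limn_einf _]limf_einfE; apply: ge_ereal_sup => _ [V Voo <-].
have [n [Vn [_ Hn]]] := filter_ex (filterI Voo Ha).
by apply: le_trans Hn; apply: ereal_inf_lbound; exists n.
Qed.

(** * Complex-valued functions and completeness *)

Implicit Types u v : T -> R[i].

Lemma orlicz_cmodD u v : C_measurable u -> C_measurable v ->
  orlicz (fun x => cmod (u x)) -> orlicz (fun x => cmod (v x)) ->
  orlicz (fun x => cmod (u x + v x)).
Proof.
move=> mu mv ou ov.
have := orliczD (measurable_cmod mu) (measurable_cmod mv) ou ov.
apply: le_orlicz; first exact/measurable_cmod/C_measurableD.
  by apply: measurable_funD; exact: measurable_cmod.
by apply: filterE => x; rewrite !ger0_norm ?addr_ge0 ?cmod_ge0// cmodD.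
Qed.

Lemma lux_cmodD u v : C_measurable u -> C_measurable v ->
  orlicz (fun x => cmod (u x)) -> orlicz (fun x => cmod (v x)) ->
  lux (fun x => cmod (u x + v x)) <=
  lux (fun x => cmod (u x)) + lux (fun x => cmod (v x)).
Proof.
move=> mu mv ou ov.
apply: le_trans (luxD (measurable_cmod mu) (measurable_cmod mv) ou ov).
apply: le_lux; first exact/measurable_cmod/C_measurableD.
- by apply: measurable_funD; exact: measurable_cmod.
- by apply: filterE => x; rewrite !ger0_norm ?addr_ge0 ?cmod_ge0// cmodD.
by apply: orliczD => //; exact: measurable_cmod.
Qed.

Lemma orlicz_cmodB u v : C_measurable u -> C_measurable v ->
  orlicz (fun x => cmod (u x)) -> orlicz (fun x => cmod (v x)) ->
  orlicz (fun x => cmod (u x - v x)).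
Proof.
move=> mu mv ou ov; apply: orlicz_cmodD => //.
  by under eq_fun do rewrite -mulN1r; exact: C_measurableZ.
by under eq_fun do rewrite cmodN.
Qed.

Lemma orlicz_cmodZ (c : R[i]) u : C_measurable u ->
  orlicz (fun x => cmod (u x)) -> orlicz (fun x => cmod (c * u x)).
Proof.
move=> mu ou; under eq_fun do rewrite cmodM.
by apply: orliczZ => //; [exact: cmod_ge0|exact: measurable_cmod].
Qed.

Lemma lux_cmodZ (c : R[i]) u : C_measurable u -> orlicz (fun x => cmod (u x)) ->
  lux (fun x => cmod (c * u x)) = cmod c * lux (fun x => cmod (u x)).
Proof.
move=> mu ou; under eq_fun do rewrite cmodM.
by apply: luxZ => //; [exact: cmod_ge0|exact: measurable_cmod].
Qed.

(** The upper limit is measurable everywhere and equals the limit wherever the latter exists; [fine]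
    sends its infinite values to 0. *)
Lemma measurable_lim_ae (w : nat -> T -> R) : (forall n, measurable_fun setT (w n)) ->
  {ae m, forall x, cvgn (fun n => w n x)} ->
  exists2 l : T -> R, measurable_fun setT l & {ae m, forall x, w n x @[n --> \oo] --> l x}.
Proof.
move=> mw cw; exists (fun x => fine (limn_esup (fun n => (w n x)%:E))).
  apply: measurableT_comp => //; apply: measurable_fun_limn_esup => n.
  exact/measurable_EFinP.
apply: filterS cw => x cx; have cE : (w n x)%:E @[n --> \oo] --> (limn (w^~ x))%:E.
  by apply/fine_cvgP; split; [exact: nearW|exact: cx].
rewrite is_cvg_limn_esupE; last by apply/cvg_ex; eexists; exact: cE.
by rewrite (cvg_lim _ cE).
Qed.

Lemma orlicz_complete (u : nat -> T -> R[i]) :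
  (forall n, C_measurable (u n)) ->
  (forall n, orlicz (fun x => cmod (u n x))) ->
  (forall e, 0 < e -> exists n0, forall n k, (n0 <= n)%N -> (n0 <= k)%N ->
    lux (fun x => cmod (u n x - u k x)) < e) ->
  exists l, [/\ C_measurable l, orlicz (fun x => cmod (l x)) &
    forall e, 0 < e -> exists n0, forall n, (n0 <= n)%N ->
      lux (fun x => cmod (u n x - l x)) < e].
Proof.
move=> mu ou uC; have [phi [phi_ge phiP]] := rapid_subsequence uC.
have mB n k : C_measurable (fun x => u n x - u k x) by exact: C_measurableB.
have mcB n k : measurable_fun setT (fun x => cmod (u n x - u k x)) by exact: measurable_cmod.
have oB n k : orlicz (fun x => cmod (u n x - u k x)) by exact: orlicz_cmodB.
(* Real and imaginary parts are treated separately, their increments being dominated by the modulus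
   of the complex increment. *)
have [lr mlr lrP] : exists2 l : T -> R, measurable_fun setT l &
    {ae m, forall x, complex.Re (u (phi n) x) @[n --> \oo] --> l x}.
  apply: measurable_lim_ae => [n|]; first by case: (mu (phi n)).
  have mD n : measurable_fun setT
      (fun x => complex.Re (u (phi n.+1) x) - complex.Re (u (phi n) x)).
    by apply: measurable_funB; [case: (mu (phi n.+1))|case: (mu (phi n))].
  have le n : {ae m, forall x, `|complex.Re (u (phi n.+1) x) - complex.Re (u (phi n) x)| <=
      `|cmod (u (phi n.+1) x - u (phi n) x)|}.
    by apply: filterE => x; rewrite -ReB (ger0_norm (cmod_ge0 _)) Re_le_cmod.
  apply: ae_is_cvgn => n; first by case: (mu (phi n)).
    exact: le_orlicz (mD n) (mcB _ _) (le n) (oB _ _).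
  exact: le_lt_trans (le_lux (mD n) (mcB _ _) (le n) (oB _ _)) (phiP n).
have [li mli liP] : exists2 l : T -> R, measurable_fun setT l &
    {ae m, forall x, complex.Im (u (phi n) x) @[n --> \oo] --> l x}.
  apply: measurable_lim_ae => [n|]; first by case: (mu (phi n)).
  have mD n : measurable_fun setT
      (fun x => complex.Im (u (phi n.+1) x) - complex.Im (u (phi n) x)).
    by apply: measurable_funB; [case: (mu (phi n.+1))|case: (mu (phi n))].
  have le n : {ae m, forall x, `|complex.Im (u (phi n.+1) x) - complex.Im (u (phi n) x)| <=
      `|cmod (u (phi n.+1) x - u (phi n) x)|}.
    by apply: filterE => x; rewrite -ImB (ger0_norm (cmod_ge0 _)) Im_le_cmod.
  apply: ae_is_cvgn => n; first by case: (mu (phi n)).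
    exact: le_orlicz (mD n) (mcB _ _) (le n) (oB _ _).
  exact: le_lt_trans (le_lux (mD n) (mcB _ _) (le n) (oB _ _)) (phiP n).
pose l x := (lr x +i* li x)%C.
have ml : C_measurable l by split.
have mBl n : C_measurable (fun x => u n x - l x) by exact: C_measurableB.
(* Fatou is applied in the subsequence index k with n fixed, to |u n - u (phi k)|, which tends to |u
   n - l| almost everywhere. *)
have key e : 0 < e -> exists n0, forall n, (n0 <= n)%N ->
    luxset (fun x => cmod (u n x - l x)) (2 * e).
  move=> e0; have [n0 n0P] := uC _ e0; exists n0 => n n0n.
  apply: (luxset_fatou (H := fun k x => cmod (u n x - u (phi k) x))) => //.
  - exact: measurable_cmod.
  - apply: filterS2 lrP liP => x xr xi; apply: cvg_cmod.
      rewrite ReB; under eq_fun do rewrite ReB.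
      by apply: cvgB => //; exact: cvg_cst.
    rewrite ImB; under eq_fun do rewrite ImB.
    by apply: cvgB => //; exact: cvg_cst.
  exists n0 => // k /= n0k; apply: lux_lt => //; apply: n0P => //.
  exact: leq_trans (phi_ge k).
exists l; split => //.
  (* Membership of l follows from l = u n0 - (u n0 - l). *)
  have [n0 /(_ _ (leqnn _)) [e0 h]] := key 1 ltr01.
  have on : orlicz (fun x => cmod (u n0 x - l x)).
    by exists (2 * 1) => //; exact: le_lt_trans h (ltry _).
  have := orlicz_cmodB (mu n0) (mBl n0) (ou n0) on.
  by under eq_fun do rewrite subKr.
(* With e / 3 the scale 2 (e / 3) from [key] is strictly below e. *)
move=> e e0; have e3 : 0 < e / 3 by rewrite divr_gt0.
have [n0 n0P] := key _ e3; exists n0 => n /n0P h.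
by apply: le_lt_trans (lux_le h) _; lra.
Qed.

End scalar_orlicz.

(** * Splitting a hyperbolic Young function into two real ones *)

Section components.
Variables (R : realType).
Local Notation D := (hyperbolic R).

(** By [D_young_split] a component of [phi] depends on the matching coordinate only, so the other
    one is frozen at 0. The absolute value makes the function even and keeps the argument in D^+. *)
Definition young1 (phi : D -> D) (s : R) : R := (phi (`|s|, 0)).1.
Definition young2 (phi : D -> D) (s : R) : R := (phi (0, `|s|)).2.

Definition Dswap (x : D) : D := (x.2, x.1).

(** Exchanging the two idempotents preserves Young functions and turns [young1] into [young2], so
    only the first component needs a proof. *)
Lemma D_young_swap (phi : D -> D) :
  D_young phi -> D_young (fun x => Dswap (phi (Dswap x))).
Proof.
case=> pos cvx phi0 lim; split.
- by move=> x [x1 x2]; have [] : 0 <=' phi (Dswap x) by apply: pos.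
- move=> a x y [? ?] [? ?] [? ?] [? ?].
  by have [] := cvx (Dswap a) (Dswap x) (Dswap y)
    (conj _ _) (conj _ _) (conj _ _) (conj _ _).
- by rewrite (_ : Dswap 0 = 0)// phi0.
move=> a v [a1 a2] [v1 v2] v0.
have [] // := lim (Dswap a) (Dswap v) (conj a2 a1) (conj v2 v1).
- by case: v v0 {v1 v2} => v1 v2 v0 [v2E v1E]; apply: v0; rewrite v1E v2E.
- by right.
by left.
Qed.

Lemma young_fun1 (phi : D -> D) : D_young phi -> young_fun (young1 phi).
Proof.
move=> phiY; have [pos cvx phi0 lim] := phiY.
have P (s : R) : 0 <= s -> 0 <=' ((s, 0) : D) by [].
have N (s : R) : 0 <=' ((`|s|, 0) : D) by exact: P.
split.
- by move=> s; have [] := pos _ (N s).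
- by rewrite /young1 normr0 [phi _]phi0.
- by move=> s t st; have [h _] := D_young_mono phiY (N s) (N t); exact: h.
- move=> c s t /andP[c0 c1]; have c1' : 0 <= 1 - c by rewrite subr_ge0.
  have [h _] := cvx (c, 0) (`|s|, 0) (`|t|, 0) (conj c0 (lexx _))
    (conj c1 ler01) (N s) (N t).
  apply: le_trans h.
  (* Convexity bounds [phi] at c |s| + (1 - c) |t|, which dominates |c s + (1 - c) t|; monotonicity
     links the two. *)
  have Q : 0 <=' ((c, 0) : D) * (`|s|, 0) + (1 - (c, 0)) * (`|t|, 0).
    by split => /=; rewrite ?mulr0 ?addr0// addr_ge0// mulr_ge0.
  have [h _] := D_young_mono phiY (N (c * s + (1 - c) * t)) Q; apply: h => /=.
  by apply: (le_trans (ler_normD _ _)); rewrite !normrM (ger0_norm c0) (ger0_norm c1').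
move=> M; have v0 : ((1, 0) : D) <> 0 by move=> [/eqP]; rewrite oner_eq0.
have E (t : R) : 0 + ((t, t) : D) * (1, 0) = (t, 0).
  by rewrite add0r; congr pair; rewrite /= ?mulr1 ?mulr0.
(* On the ray from 0 in direction (1, 0) the second component of [phi] is constantly 0, so it must
   be the first that tends to infinity. *)
have [|] := lim 0 (1, 0) (P 0 (lexx _)) (P 1 ler01) v0.
  move/cvgryPgt => /(_ M) [A [_ hA]].
  exists (Num.max (A + 1) 0); rewrite /young1 ger0_norm ?le_max ?lexx ?orbT//.
  by rewrite -E; apply: hA; rewrite lt_max ltrDl ltr01.
move/cvgryPgt => /(_ 0) [A [_ hA]].
have := hA (Num.max (A + 1) 0); rewrite lt_max ltrDl ltr01 => /(_ isT).
rewrite E; have t0 : 0 <= Num.max (A + 1) 0 by rewrite le_max lexx orbT.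
have [_ ->//] := D_young_split phiY (P _ t0) (P 0 (lexx _)).
by rewrite [phi _]phi0 ltxx.
Qed.

Lemma young_fun2 (phi : D -> D) : D_young phi -> young_fun (young2 phi).
Proof. by move=> /D_young_swap/young_fun1. Qed.

Lemma D_young_componentE (phi : D -> D) (x : D) : D_young phi -> 0 <=' x ->
  phi x = (young1 phi x.1, young2 phi x.2).
Proof.
move=> phiY [x1 x2]; rewrite [LHS]surjective_pairing /young1 /young2 !ger0_norm//.
have [h1 _] := D_young_split (y := (x.1, 0)) phiY (conj x1 x2) (conj x1 (lexx _)).
have [_ h2] := D_young_split (y := (0, x.2)) phiY (conj x1 x2) (conj (lexx _) x2).
by rewrite h1// h2.
Qed.

Lemma young1_norm (phi : D -> D) s : young1 phi `|s| = young1 phi s.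
Proof. by rewrite /young1 normr_id. Qed.

Lemma young2_norm (phi : D -> D) s : young2 phi `|s| = young2 phi s.
Proof. by rewrite /young2 normr_id. Qed.

End components.

(** * Modular, membership and norm in idempotent components *)

Section D_orlicz_components.
Variables (d : measure_display) (T : measurableType d) (R : realType).
Variables (mu : D_finite_measure T R) (phi : hyperbolic R -> hyperbolic R).
Hypothesis phiY : D_young phi.
Local Notation fBC := (T -> (bicomplex R)^o).

Definition abs1 (f : fBC) x := cmod (bcw1 (f x)).
Definition abs2 (f : fBC) x := cmod (bcw2 (f x)).
Definition orlicz1 (f : fBC) := orlicz (Dmu1 mu) (young1 phi) (abs1 f).
Definition orlicz2 (f : fBC) := orlicz (Dmu2 mu) (young2 phi) (abs2 f).
Definition lux1 (f : fBC) := lux (Dmu1 mu) (young1 phi) (abs1 f).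
Definition lux2 (f : fBC) := lux (Dmu2 mu) (young2 phi) (abs2 f).

Lemma D_modularE (f : fBC) : D_modular mu phi f =
  (\int[Dmu1 mu]_x (young1 phi (abs1 f x))%:E,
   \int[Dmu2 mu]_x (young2 phi (abs2 f x))%:E)%E.
Proof.
by congr pair; apply: eq_integral => x _;
  rewrite (D_young_componentE phiY (bc_abs_ge0 _)).
Qed.

Lemma D_modular_mulE (f : fBC) (a : hyperbolic R) : 0 <' a ->
  D_modular mu phi (fun x => D_bc a * f x) =
  (modular (Dmu1 mu) (young1 phi) (abs1 f) a.1^-1,
   modular (Dmu2 mu) (young2 phi) (abs2 f) a.2^-1).
Proof.
move=> [a1 a2]; rewrite D_modularE; congr pair; apply: eq_integral => x _.
  by rewrite /abs1 bcw1M bcw1_D cmodM cmodR gtr0_norm// invrK mulrC.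
by rewrite /abs2 bcw2M bcw2_D cmodM cmodR gtr0_norm// invrK mulrC.
Qed.

Lemma D_modular_divE (f : fBC) (a : hyperbolic R) : 0 <' a ->
  D_modular mu phi (fun x => D_bc (bc_abs (f x) / a)) =
  (modular (Dmu1 mu) (young1 phi) (abs1 f) a.1,
   modular (Dmu2 mu) (young2 phi) (abs2 f) a.2).
Proof.
move=> a0; rewrite D_modularE; congr pair; apply: eq_integral => x _.
  by rewrite /abs1 bcw1_D D_divE// cmodR young1_norm.
by rewrite /abs2 bcw2_D D_divE// cmodR young2_norm.
Qed.

Lemma D_orlicz_funE (f : fBC) :
  D_orlicz_fun mu phi f <-> orlicz1 f /\ orlicz2 f.
Proof.
split=> [[a a0]|[[a1 a10 h1] [a2 a20 h2]]].
  rewrite D_modular_mulE//= => -[h1 h2]; have [a1 a2] := a0.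
  by split; [exists a.1^-1|exists a.2^-1]; rewrite ?invr_gt0.
have a0 : 0 <' ((a1^-1, a2^-1) : hyperbolic R) by split; rewrite /= invr_gt0.
by exists (a1^-1, a2^-1) => //; rewrite D_modular_mulE//= !invrK.
Qed.

Lemma measurable_abs1 (f : BC_mfun T R) : measurable_fun setT (abs1 f).
Proof. by have [m1 _] := BC_mfun_measurable f; exact: measurable_cmod. Qed.

Lemma measurable_abs2 (f : BC_mfun T R) : measurable_fun setT (abs2 f).
Proof. by have [_ m2] := BC_mfun_measurable f; exact: measurable_cmod. Qed.

(** The admissible hyperbolic scales form the product of two real sets. Projecting it onto one
    factor recovers that factor because the other is nonempty: [b1] and [b2] complete the missing
    coordinate. *)
Lemma D_luxemburg_funE (f : BC_mfun T R) : orlicz1 f -> orlicz2 f ->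
  D_luxemburg_fun mu phi f = (lux1 f, lux2 f).
Proof.
move=> o1 o2.
have [[b1 hb1] _] := luxset_has_inf (young_fun1 phiY) (measurable_abs1 f) o1.
have [[b2 hb2] _] := luxset_has_inf (young_fun2 phiY) (measurable_abs2 f) o2.
have E (a : hyperbolic R) : (0 <' a /\
      let I := D_modular mu phi (fun x => D_bc (bc_abs (f x) / a)) in
      (I.1 <= 1 /\ I.2 <= 1)%E) <->
    luxset (Dmu1 mu) (young1 phi) (abs1 f) a.1 /\
    luxset (Dmu2 mu) (young2 phi) (abs2 f) a.2.
  split=> [[a0]|[[a1 h1] [a2 h2]]].
    by rewrite D_modular_divE//= => -[h1 h2]; case: a0.
  by split => //; rewrite D_modular_divE.
congr pair; congr inf; apply/seteqP; split.
- by move=> _ [a /E[h _] <-].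
- by move=> a ha; exists (a, b2) => //; apply/E.
- by move=> _ [a /E[_ h] <-].
- by move=> a ha; exists (b1, a) => //; apply/E.
Qed.

Lemma D_orlicz_piE (f : BC_mfun T R) :
  D_orlicz mu phi (\pi_(BC_L0 mu)%qT f) <-> orlicz1 f /\ orlicz2 f.
Proof. by rewrite -D_orlicz_funE; exact: D_orlicz_pi. Qed.

Lemma D_luxemburg_piE (f : BC_mfun T R) : orlicz1 f -> orlicz2 f ->
  D_luxemburg mu phi (\pi_(BC_L0 mu)%qT f) = (lux1 f, lux2 f).
Proof. by move=> o1 o2; rewrite D_luxemburg_pi// D_luxemburg_funE. Qed.

Lemma BC_L0_pi0 : \pi_(BC_L0 mu)%qT (0 : BC_mfun T R) = 0.
Proof.
have := BC_L0_piD mu 0 0; rewrite addr0 => /(congr1 (fun c => c - \pi_(BC_L0 mu)%qT 0)).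
by rewrite subrr addrK.
Qed.

Lemma BC_L0_piB (f g : BC_mfun T R) :
  \pi_(BC_L0 mu)%qT (f - g) = \pi_(BC_L0 mu)%qT f - \pi_(BC_L0 mu)%qT g.
Proof. by apply/(canRL (addrK _)); rewrite -BC_L0_piD subrK. Qed.

Lemma BC_L0_piZ a (f : BC_mfun T R) :
  \pi_(BC_L0 mu)%qT (a *: f) = a *: \pi_(BC_L0 mu)%qT f.
Proof. exact: BC_L0_pi_scale. Qed.

End D_orlicz_components.

(** * Module structure, norm axioms and completeness over the bicomplex numbers *)

Section luxemburg_module.
Variables (d : measure_display) (T : measurableType d) (R : realType).
Variables (mu : D_finite_measure T R) (phi : hyperbolic R -> hyperbolic R).
Hypothesis phiY : D_young phi.
Local Notation pi := (\pi_(BC_L0 mu)%qT).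
Local Notation L := (D_orlicz mu phi).
Local Notation N := (D_luxemburg mu phi).
Local Notation o1 := (orlicz1 mu phi).
Local Notation o2 := (orlicz2 mu phi).
Local Notation l1 := (lux1 mu phi).
Local Notation l2 := (lux2 mu phi).
Local Notation pY1 := (young_fun1 phiY).
Local Notation pY2 := (young_fun2 phiY).
Implicit Types f g : BC_mfun T R.

Lemma C_measurable1 f : C_measurable (fun x => bcw1 (f x)).
Proof. by case: (BC_mfun_measurable f). Qed.

Lemma C_measurable2 f : C_measurable (fun x => bcw2 (f x)).
Proof. by case: (BC_mfun_measurable f). Qed.

Lemma abs1D f g : abs1 (f + g) = fun x => cmod (bcw1 (f x) + bcw1 (g x)).
Proof. by apply/funext => x; rewrite /abs1 -bcw1D. Qed.

Lemma abs2D f g : abs2 (f + g) = fun x => cmod (bcw2 (f x) + bcw2 (g x)).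
Proof. by apply/funext => x; rewrite /abs2 -bcw2D. Qed.

Lemma abs1Z a f : abs1 (a *: f) = fun x => cmod (bcw1 a * bcw1 (f x)).
Proof. by apply/funext => x; rewrite /abs1 -bcw1M. Qed.

Lemma abs2Z a f : abs2 (a *: f) = fun x => cmod (bcw2 a * bcw2 (f x)).
Proof. by apply/funext => x; rewrite /abs2 -bcw2M. Qed.

Lemma abs1B f g : abs1 (f - g) = fun x => cmod (bcw1 (f x) - bcw1 (g x)).
Proof.
apply/funext => x; have := congr1 (@bcw1 R) (subrK (g x) (f x)).
by rewrite bcw1D => <-; rewrite addrK.
Qed.

Lemma abs2B f g : abs2 (f - g) = fun x => cmod (bcw2 (f x) - bcw2 (g x)).
Proof.
apply/funext => x; have := congr1 (@bcw2 R) (subrK (g x) (f x)).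
by rewrite bcw2D => <-; rewrite addrK.
Qed.

Lemma orliczD12 f g : o1 f /\ o2 f -> o1 g /\ o2 g -> o1 (f + g) /\ o2 (f + g).
Proof.
move=> [f1 f2] [g1 g2]; rewrite /orlicz1 /orlicz2 abs1D abs2D.
by split; apply: orlicz_cmodD;
  do ?[exact: pY1|exact: pY2|exact: C_measurable1|exact: C_measurable2].
Qed.

Lemma orliczZ12 a f : o1 f /\ o2 f -> o1 (a *: f) /\ o2 (a *: f).
Proof.
move=> [f1 f2]; rewrite /orlicz1 /orlicz2 abs1Z abs2Z.
by split; apply: orlicz_cmodZ;
  do ?[exact: pY1|exact: pY2|exact: C_measurable1|exact: C_measurable2].
Qed.

Lemma orliczB12 f g : o1 f /\ o2 f -> o1 g /\ o2 g -> o1 (f - g) /\ o2 (f - g).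
Proof. by move=> hf hg; rewrite -[- g]scaleN1r; apply: orliczD12 => //; exact: orliczZ12. Qed.

Lemma D_orlicz_submodule : bc_submodule L.
Proof.
split.
- rewrite -BC_L0_pi0; apply/(D_orlicz_piE mu phiY _); split.
    rewrite /orlicz1 (_ : abs1 _ = fun=> 0); first exact: orlicz0 pY1.
    by apply/funext => x; rewrite /abs1 bcw1_0; apply/cmod0_eq0.
  rewrite /orlicz2 (_ : abs2 _ = fun=> 0); first exact: orlicz0 pY2.
  by apply/funext => x; rewrite /abs2 bcw2_0; apply/cmod0_eq0.
- elim/quotW => f; elim/quotW => g /(D_orlicz_piE mu phiY _) hf /(D_orlicz_piE mu phiY _) hg.
  by rewrite -BC_L0_piD; apply/(D_orlicz_piE mu phiY _)/orliczD12.
move=> a; elim/quotW => f /(D_orlicz_piE mu phiY _) hf.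
by rewrite -BC_L0_piZ; apply/(D_orlicz_piE mu phiY _)/orliczZ12.
Qed.

Lemma D_luxemburg_norm : D_norm L N.
Proof.
split.
- elim/quotW => f /(D_orlicz_piE mu phiY _)[f1 f2].
  by rewrite D_luxemburg_piE//; split; exact: lux_ge0.
- elim/quotW => f /(D_orlicz_piE mu phiY _)[f1 f2].
  (* Zero is written as the class of the zero function, so that [BC_L0P] turns equality into almost
     everywhere equality. *)
  suff : N (pi f) = 0 <-> pi f = pi 0 by rewrite BC_L0_pi0.
  rewrite D_luxemburg_piE//; split.
    case=> h1 h2; apply/BC_L0P; split.
      have := lux_eq0 pY1 (measurable_abs1 f) f1 h1.
      by apply: filterS => x /cmod0_eq0 ->; rewrite bcw1_0.
    have := lux_eq0 pY2 (measurable_abs2 f) f2 h2.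
    by apply: filterS => x /cmod0_eq0 ->; rewrite bcw2_0.
  move=> /BC_L0P[h1 h2]; congr pair.
    apply: (lux_eq0W pY1 (measurable_abs1 f)); apply: filterS h1 => x e.
    by apply/cmod0_eq0; rewrite e bcw1_0.
  apply: (lux_eq0W pY2 (measurable_abs2 f)); apply: filterS h2 => x e.
  by apply/cmod0_eq0; rewrite e bcw2_0.
- move=> a; elim/quotW => f /(D_orlicz_piE mu phiY _)[f1 f2].
  have [af1 af2] := orliczZ12 a (conj f1 f2).
  rewrite -BC_L0_piZ !D_luxemburg_piE//; congr pair.
    by rewrite /lux1 abs1Z; apply: lux_cmodZ => //; [exact: pY1|exact: C_measurable1].
  by rewrite /lux2 abs2Z; apply: lux_cmodZ => //; [exact: pY2|exact: C_measurable2].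
elim/quotW => f; elim/quotW => g /(D_orlicz_piE mu phiY _)[f1 f2] /(D_orlicz_piE mu phiY _)[g1 g2].
have [fg1 fg2] := orliczD12 (conj f1 f2) (conj g1 g2).
rewrite -BC_L0_piD !D_luxemburg_piE//; split => /=.
  rewrite /lux1 abs1D; apply: lux_cmodD => //; by [exact: pY1|exact: C_measurable1].
rewrite /lux2 abs2D; apply: lux_cmodD => //; by [exact: pY2|exact: C_measurable2].
Qed.

Lemma D_luxemburg_complete : D_complete L N.
Proof.
move=> u uL uC; pose F n : BC_mfun T R := repr (u n).
have uE n : u n = pi (F n) by rewrite reprK.
have oF n : o1 (F n) /\ o2 (F n) by apply/(D_orlicz_piE mu phiY _); rewrite -uE.
have NB f g : o1 f /\ o2 f -> o1 g /\ o2 g ->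
    N (pi f - pi g) = (l1 (f - g), l2 (f - g)).
  by move=> hf hg; have [h1 h2] := orliczB12 hf hg; rewrite -BC_L0_piB D_luxemburg_piE.
(* The hyperbolic radius (e, e) gives the real Cauchy condition in both components at once. *)
have C e : 0 < e -> exists n0, forall n k, (n0 <= n)%N -> (n0 <= k)%N ->
    l1 (F n - F k) < e /\ l2 (F n - F k) < e.
  move=> e0; have [n0 h] := uC (e, e) (conj e0 e0); exists n0 => n k nn kn.
  by have := h n k nn kn; rewrite !uE NB.
have [v1 [mv1 ov1 cv1]] := orlicz_complete pY1 (fun n => C_measurable1 (F n))
  (fun n => proj1 (oF n)) (fun e e0 => ltac:(have [n0 h] := C e e0; exists n0 => n k nn kn;
    have [+ _] := h n k nn kn; by rewrite /lux1 abs1B)).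
have [v2 [mv2 ov2 cv2]] := orlicz_complete pY2 (fun n => C_measurable2 (F n))
  (fun n => proj2 (oF n)) (fun e e0 => ltac:(have [n0 h] := C e e0; exists n0 => n k nn kn;
    have [_ +] := h n k nn kn; by rewrite /lux2 abs2B)).
(* The two complex limits are glued along the idempotents. *)
pose V x : (bicomplex R)^o := bcC (v1 x) * bce1 R + bcC (v2 x) * bce2 R.
have V1 x : bcw1 (V x) = v1 x by rewrite bcwE.
have V2 x : bcw2 (V x) = v2 x by rewrite bcwE.
have mV : V \in @BC_mfun_pred _ T R.
  by apply/asboolP; split; [under eq_fun do rewrite V1|under eq_fun do rewrite V2].
pose G : BC_mfun T R := BCMfun mV.
have oG : o1 G /\ o2 G.
  rewrite /orlicz1 /orlicz2 /abs1 /abs2 /=.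
  by split; [under eq_fun do rewrite V1|under eq_fun do rewrite V2].
exists (pi G); first exact/(D_orlicz_piE mu phiY _).
move=> [e1 e2] [/= e10 e20]; have [n1 h1] := cv1 _ e10; have [n2 h2] := cv2 _ e20.
exists (maxn n1 n2) => n; rewrite geq_max => /andP[/h1 {}h1 /h2 {}h2].
have E1 : abs1 (F n - G) = fun x => cmod (bcw1 (F n x) - v1 x).
  by rewrite abs1B; apply/funext => x; rewrite /= V1.
have E2 : abs2 (F n - G) = fun x => cmod (bcw2 (F n x) - v2 x).
  by rewrite abs2B; apply/funext => x; rewrite /= V2.
rewrite uE (NB _ _ (oF n) oG); split.
  by change (l1 (F n - G) < e1); rewrite /lux1 E1.
by change (l2 (F n - G) < e2); rewrite /lux2 E2.
Qed.

End luxemburg_module.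

Theorem theorem4p12 (d : measure_display) (T : measurableType d) (R : realType)
    (mu : D_finite_measure T R) (phi : (R * R)%type -> (R * R)%type)
    (hphi : D_young phi) :
  complete_D_normed_module (D_orlicz mu phi) (D_luxemburg mu phi).
Proof.
split; [exact: D_orlicz_submodule|exact: D_luxemburg_norm|exact: D_luxemburg_complete].
Qed.
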